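(* Let $p\ge 2$, let $\tau>0$, and let $\kappa>0$ satisfy $A_p(\kappa)\,\kappa = 1/\tau$, where $A_p(\kappa)=I_{p/2}(\kappa)/I_{p/2-1}(\kappa)$. For a unit vector $z\in\mathbb{S}^{p-1}$ let $\mathcal{D}(z)$ denote the von Mises–Fisher distribution on $\mathbb{S}^{p-1}$ with mean direction $z$ and concentration $\kappa$ (this is the case $m=1$ of a single view per distribution, with both distributions having the same concentration $\kappa_1=\kappa_2=\kappa$). Define $\mathrm{sim}_{\mathrm{cos}}(x,y)=x^{T}y$ and $\mathrm{sim}_{\mathrm{div}}(\mathcal{D}_1,\mathcal{D}_2)=-D_{\mathrm{KL}}(\mathcal{D}_1\,\|\,\mathcal{D}_2)$. Then there is a constant $C$ (not depending on $z_i,z_j$) such that for all $z_i,z_j\in\mathbb{S}^{p-1}$, $$\mathrm{sim}_{\mathrm{div}}(\mathcal{D}(z_i),\mathcal{D}(z_j)) = \frac{\mathrm{sim}_{\mathrm{cos}}(z_i,z_j)}{\tau} + C.$$ Furthermore, for any anchor $z_i$, positive $z_i^{+}$ and negatives $z_j$ ($j\neq i$, $K$ of them) in $\mathbb{S}^{p-1}$, the InfoNCE loss computed with $\mathrm{sim}_{\mathrm{div}}$ on the distributions $\mathcal{D}(z_i),\mathcal{D}(z_i^+),\mathcal{D}(z_j)$ equals the InfoNCE loss computed with $\mathrm{sim}_{\mathrm{cos}}$ and temperature $\tau$ on $z_i,z_i^+,z_j$: $$L^{\mathrm{div}}_{i,\mathrm{InfoNCE}} = L^{\mathrm{cos}}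_{i,\mathrm{InfoNCE}}.$$
   Context: $I_\nu$ denotes the modified Bessel function of the first kind of order $\nu$. The von Mises–Fisher (vMF) distribution $\mathcal{D}(\mu,\kappa)$ on the unit sphere $\mathbb{S}^{p-1}\subset\mathbb{R}^p$ with mean direction $\mu\in\mathbb{S}^{p-1}$ and concentration $\kappa>0$ has density $f_p(x;\mu,\kappa)=c_p(\kappa)\exp(\kappa\,\mu^{T}x)$ with respect to surface measure, where $c_p(\kappa)=\kappa^{p/2-1}/\big((2\pi)^{p/2}I_{p/2-1}(\kappa)\big)$. $D_{\mathrm{KL}}(P\|Q)$ is the Kullback–Leibler divergence. The InfoNCE losses are $$L^{\mathrm{div}}_{i,\mathrm{InfoNCE}}=-\log\frac{e^{\mathrm{sim}_{\mathrm{div}}(\mathcal{D}_i,\mathcal{D}_i^+)}}{e^{\mathrm{sim}_{\mathrm{div}}(\mathcal{D}_i,\mathcal{D}_i^+)}+\sum_{j\neq i}^{K}e^{\mathrm{sim}_{\mathrm{div}}(\mathcal{D}_i,\mathcal{D}_j)}},\qquad L^{\mathrm{cos}}_{i,\mathrm{InfoNCE}}=-\log\frac{e^{\mathrm{sim}_{\mathrm{cos}}(z_i,z_i^+)/\tau}}{e^{\mathrm{sim}_{\mathrm{cos}}(z_i,z_i^+)/\tau}+\sum_{j\neq i}^{K}e^{\mathrm{sim}_{\mathrm{cos}}(z_i,z_j)/\tau}},$$ where $\mathcal{D}_i=\mathcal{D}(z_i)$, $\mathcal{D}_i^+=\mathcal{D}(z_i^+)$, $\mathcal{D}_j=\mathcal{D}(z_j)$.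 *)

(* Defs.v *)
From HB Require Import structures.
From mathcomp Require Import all_boot all_order all_algebra.
From mathcomp Require Import all_classical all_reals all_analysis.
Set Implicit Arguments. Unset Strict Implicit. Unset Printing Implicit Defensive.
Import Order.TTheory GRing.Theory Num.Theory.
Import numFieldNormedType.Exports.
Local Open Scope classical_set_scope.
Local Open Scope ring_scope.

Section Defs.
Variable R : realType.

Definition dotp (p : nat) (x y : 'rV[R]_p) : R := \sum_(i < p) x 0 i * y 0 i.
Definition enorm (p : nat) (x : 'rV[R]_p) : R := Num.sqrt (dotp x x).
Definition unit_sphere (p : nat) (x : 'rV[R]_p) : Prop := enorm x = 1.

Definition Gamma (s : R) : R :=
  fine (\int[lebesgue_measure]_(t in [set t : R | (0 < t)%R])
          ((powR t (s - 1) * expR (- t))%R)%:E)%E.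

Definition besselI (nu x : R) : R :=
  limn (fun n : nat => \sum_(0 <= k < n)
          ((x / 2) `^ (2 * k%:R + nu) / (k`!%:R * Gamma (k%:R + nu + 1)))).

Definition Ap (p : nat) (kappa : R) : R :=
  besselI (p%:R / 2) kappa / besselI (p%:R / 2 - 1) kappa.

Definition vmf_c (p : nat) (kappa : R) : R :=
  kappa `^ (p%:R / 2 - 1) / ((2 * pi) `^ (p%:R / 2) * besselI (p%:R / 2 - 1) kappa).

Definition vmf_density (p : nat) (kappa : R) (mu : 'rV[R]_p) (x : 'rV[R]_p) : R :=
  vmf_c p kappa * expR (kappa * dotp mu x).

Fixpoint iter_int (n : nat) (f : seq R -> \bar R) : \bar R :=
  match n with
  | 0 => f [::]
  | n'.+1 => (\int[lebesgue_measure]_x iter_int n' (fun s => f (x :: s)))%E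
  end.

Definition lebesgue_int (p : nat) (g : 'rV[R]_p -> \bar R) : \bar R :=
  iter_int p (fun s => g (\row_(i < p) nth 0 s i)).

(* Integral against the surface measure sigma of S^{p-1}, via the cone
   formula  int_S g dsigma = p * int_{0<|x|<=1} g(x/|x|) dx. *)
Definition sphere_int (p : nat) (g : 'rV[R]_p -> \bar R) : \bar R :=
  ((p%:R)%:E * lebesgue_int (fun x : 'rV[R]_p =>
     if ((0 < enorm x) && (enorm x <= 1))%R then g ((enorm x)^-1 *: x) else 0%E))%E.

Definition KL_sphere (p : nat) (f1 f2 : 'rV[R]_p -> R) : \bar R :=
  sphere_int (fun x => ((f1 x * ln (f1 x / f2 x))%R)%:E).

Definition sim_div_e (p : nat) (f1 f2 : 'rV[R]_p -> R) : \bar R :=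
  (- KL_sphere f1 f2)%E.
Definition sim_div (p : nat) (f1 f2 : 'rV[R]_p -> R) : R := fine (sim_div_e f1 f2).

Definition sim_cos (p : nat) (x y : 'rV[R]_p) : R := dotp x y.

Definition infoNCE (N : nat) (i : 'I_N) (spos : R) (sneg : 'I_N -> R) : R :=
  - ln (expR spos / (expR spos + \sum_(j < N | j != i) expR (sneg j))).

Definition L_div (p : nat) (kappa : R) (N : nat) (i : 'I_N)
  (z : 'I_N -> 'rV[R]_p) (zplus : 'rV[R]_p) : R :=
  infoNCE i (sim_div (vmf_density kappa (z i)) (vmf_density kappa zplus))
            (fun j => sim_div (vmf_density kappa (z i)) (vmf_density kappa (z j))).

Definition L_cos (p : nat) (tau : R) (N : nat) (i : 'I_N)
  (z : 'I_N -> 'rV[R]_p) (zplus : 'rV[R]_p) : R :=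
  infoNCE i (sim_cos (z i) zplus / tau) (fun j => sim_cos (z i) (z j) / tau).

End Defs.

(* Main.v *)
Require Import Defs.
From HB Require Import structures.
From mathcomp Require Import all_boot all_order all_algebra.
From mathcomp Require Import all_classical all_reals all_analysis.
From mathcomp Require Import measurable_realfun ring lra.
Import Order.TTheory GRing.Theory Num.Theory.
Import numFieldNormedType.Exports.
Local Open Scope ring_scope.
Local Open Scope classical_set_scope.

(** Expanding [ln (f1 / f2)] reduces the divergence to the first moment of the
    exponentially tilted surface measure, [int_S e^(t.x) (v.x)] with
    [t = kappa zi] and [v = zi - zj].  This moment is computed without rotation
    invariance.  The Gaussian integral of [e^(t.x)] factors over the coordinates,
    and comparing power series yields the Gaussian moments of [(t.x)^(2j)].  By
    homogeneity and Tonelli these are [Gamma (p/2 + j + 1)] times moments of the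
    unit ball, and the latter determine the moments of the sphere.  Hence
    [int_S e^(t.x) = H(|t|^2)] for an explicit entire series [H].  As a function of
    [s], [int_S e^((t + s v).x)] lies above its tangent
    [int_S e^(t.x) (1 + s v.x)], so the tilted first moment is
    [d/ds H(|t + s v|^2)] at [s = 0]; its coefficients are those of [I_(p/2)]. *)

(** * Iterated integrals as integrals over a product space *)

(** The surface integral is encoded by iterated one-dimensional integrals, on which maps acting
    coordinate by coordinate, here dilations and the reflection [x -> - x], are tractable, whereas a
    rotation mixes the coordinates. That integrals of functions of [t.x] depend on [t] only through
    [|t|^2] is therefore drawn from the Gaussian, which is at once a product over the coordinates
    and a function of the norm. In the moment computation only even powers and [cosh] are expanded,
    so every exchange of sums and integrals concerns nonnegative functions and takes place in
    [\bar R] before anything is known to be finite. Finiteness, that of the Gamma values included,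
    is read off afterwards from the explicit Gaussian integrals. *)

Section lebesgue_prod.
Context {R : realType} d (T : measurableType d).
Variable m : {sigma_finite_measure set T -> \bar R}.

(* A copy of [\x]: canonical inference only finds a sigma-finite structure on
   products of subprobabilities. *)
Definition lebesgue_prod : set (measurableTypeR R * T) -> \bar R :=
  (lebesgue_measure \x m)%E.

HB.instance Definition _ := Measure.on lebesgue_prod.

Lemma lebesgue_prod_sigma_finite : sigma_finite setT lebesgue_prod.
Proof.
have /sigma_finiteP[F [TF ndF Foo]] := sigma_finiteT (@lebesgue_measure R).
have /sigma_finiteP[G [TG ndG Goo]] := sigma_finiteT m.
exists (fun n => F n `*` G n).
  apply/esym; rewrite -subTset => -[x y] _.
  have [[i _ Fx] [j _ Gy]] : (\bigcup_i F i) x /\ (\bigcup_i G i) y.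
    by rewrite -TF -TG.
  exists (maxn i j) => //; split.
    by move: x Fx; exact/subsetPset/ndF/leq_maxl.
  by move: y Gy; exact/subsetPset/ndG/leq_maxr.
move=> n; have [mF Fn] := Foo n; have [mG Gn] := Goo n.
split; first exact: measurableX.
by rewrite [X in (X < _)%E]product_measure1E// lte_mul_pinfty// ge0_fin_numE.
Qed.

HB.instance Definition _ :=
  @Measure_isSigmaFinite.Build _ _ R lebesgue_prod lebesgue_prod_sigma_finite.

End lebesgue_prod.

Lemma measurable_funEFin d (T : measurableType d) (R : realType) (f : T -> R) :
  measurable_fun setT f -> measurable_fun setT (fun x => (f x)%:E).
Proof. by move=> mf; apply/measurable_EFinP. Qed.

(* [cube n] realizes [iter_int n] as a single integral; the display of the
   [n]-fold product depends on [n], hence the bundling. *)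
Record seq_space (R : realType) := SeqSpace {
  ss_display : measure_display;
  ss_type : measurableType ss_display;
  ss_mu : {sigma_finite_measure set ss_type -> \bar R};
  ss_seq : ss_type -> seq R }.

Fixpoint cube {R : realType} (n : nat) : seq_space R :=
  if n is m.+1 then
    SeqSpace R _ (measurableTypeR R * ss_type R (cube m))%type
      (lebesgue_prod _ _ (ss_mu R (cube m)))
      (fun x => x.1 :: ss_seq R (cube m) x.2)
  else SeqSpace R _ unit (dirac tt) (fun=> [::]).

Arguments ss_mu {R}.
Arguments ss_seq {R s}.

Section iter_int.
Context {R : realType}.
Local Notation T n := (ss_type R (cube n)).
Local Notation mu n := (ss_mu (cube n)).

Lemma measurable_ss_seq n i :
  measurable_fun [set: T n] (fun x => nth 0 (ss_seq x) i : R).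
Proof.
elim: n i => [|n IH] [|i] /=; try exact: measurable_cst.
  exact: measurable_fst.
exact: (measurableT_comp (IH i)).
Qed.

Lemma iter_int_ge0E n (f : seq R -> \bar R) :
  measurable_fun [set: T n] (fun x => f (ss_seq x)) -> (forall s, 0 <= f s)%E ->
  iter_int n f = (\int[mu n]_x f (ss_seq x))%E.
Proof.
elim: n f => [|n IH] f mf f0 /=.
  by rewrite integral_dirac ?diracT ?mul1e.
rewrite fubini_tonelli1 //=.
apply: eq_integral => x _; rewrite IH//.
exact: (measurableT_comp mf (pair1_measurable x)).
Qed.

Lemma iter_int_prod n (h : nat -> R -> R) :
  (forall i, measurable_fun setT (h i)) -> (forall i x, 0 <= h i x) ->
  iter_int n (fun s => (\prod_(i < n) h i (nth 0 s i))%:E) =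
  (\prod_(i < n) \int[lebesgue_measure]_x (h i x)%:E)%E.
Proof.
elim: n h => [|n IH] h mh h0 /=; first by rewrite !big_ord0.
have P0 (k : nat -> R -> R) s : (forall i x, 0 <= k i x) ->
  (0 <= (\prod_(i < n) k i (nth 0 s i))%:E)%E.
  by move=> k0; rewrite lee_fin prodr_ge0.
have mP (k : nat -> R -> R) : (forall i, measurable_fun setT (k i)) ->
  measurable_fun [set: T n] ((fun s => (\prod_(i < n) k i (nth 0 s i))%:E) \o ss_seq).
  move=> mk; apply/measurable_EFinP; apply: measurable_prod => i _.
  exact: (measurableT_comp (mk i) (measurable_ss_seq n i)).
have {}IH := IH _ (fun i => mh i.+1) (fun i => h0 i.+1).
have {}mP := mP _ (fun i => mh i.+1).
have {}P0 s := P0 (fun i => h i.+1) s (fun i => h0 i.+1).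
rewrite big_ord_recl -IH iter_int_ge0E// -ge0_integralZr//; last 3 first.
- exact: measurable_funEFin (mh 0%N).
- by move=> x _; rewrite lee_fin.
- by apply: integral_ge0 => s _; exact: P0.
apply: eq_integral => x _.
rewrite -ge0_integralZl ?lee_fin//.
rewrite iter_int_ge0E.
- by apply: eq_integral => s _; rewrite -EFinM big_ord_recl.
- under [X in measurable_fun _ X]eq_fun do rewrite /= big_ord_recl EFinM/=.
  exact: measurable_funeM.
- by move=> s; rewrite lee_fin prodr_ge0.
Qed.

(** A signed integrand needs Fubini, hence integrability at every level of the iteration. A bound by
    a product of one-variable integrable functions survives fixing the first coordinate at [x],
    which only turns [M] into [M * h x]. *)
Lemma iter_int_dominatedE n (h : R -> R) (M : R) (f : seq R -> R) :
  measurable_fun setT h -> (forall x, 0 <= h x) ->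
  (\int[lebesgue_measure]_x (h x)%:E < +oo)%E ->
  measurable_fun [set: T n] (f \o ss_seq) ->
  (forall s, `|f s| <= M * \prod_(i < n) h (nth 0 s i)) ->
  (mu n).-integrable [set: T n] (EFin \o f \o ss_seq) /\
  iter_int n (EFin \o f) = (\int[mu n]_x (f (ss_seq x))%:E)%E.
Proof.
move=> mh h0 hoo; elim: n M f => [|n IH] M f mf fM.
  split; last by rewrite /= integral_dirac ?diracT ?mul1e.
  apply/integrableP; split; first exact: measurable_funEFin.
  by rewrite integral_dirac// diracT mul1e ltry.
have fi : (mu n.+1).-integrable [set: T n.+1] (EFin \o f \o ss_seq).
  apply/integrableP; split; first exact: measurable_funEFin.
  have M0 : 0 <= `|M| by [].
  have mp : measurable_fun [set: T n.+1]
      (fun s => \prod_(i < n.+1) h (nth 0 (ss_seq s) i)).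
    apply: measurable_prod => i _.
    exact: (measurableT_comp mh (measurable_ss_seq n.+1 i)).
  apply: (@le_lt_trans _ _
    (\int[mu n.+1]_x (`|M|%:E * (\prod_(i < n.+1) h (nth 0 (ss_seq x) i))%:E))%E).
    apply: ge0_le_integral => //=.
    - by apply: measurable_funEFin; apply: measurableT_comp mf.
    - exact: measurable_funeM (measurable_funEFin _ _ _ _ mp).
    - move=> x _; rewrite -EFinM lee_fin (le_trans (fM _))//.
      by rewrite ler_wpM2r ?prodr_ge0 ?ler_norm.
  rewrite ge0_integralZl//; last 2 first.
  - exact: measurable_funEFin.
  - by move=> x _; rewrite lee_fin prodr_ge0.
  rewrite lte_mul_pinfty//.
  rewrite -(iter_int_ge0E _ (fun s => (\prod_(i < n.+1) h (nth 0 s i))%:E)).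
  - rewrite (iter_int_prod _ (fun=> h))//.
    have hf : (\int[lebesgue_measure]_x (h x)%:E)%E \is a fin_num.
      by rewrite ge0_fin_numE ?integral_ge0// => x _; rewrite lee_fin.
    by rewrite -(fineK hf) prodEFin ltry.
  - exact: measurable_funEFin.
  - by move=> s; rewrite lee_fin prodr_ge0.
split=> //.
rewrite /= -(integral12_prod_meas1 fi).
apply: eq_integral => x _.
have [] := IH (M * h x) (fun s => f (x :: s)) => //.
- exact: (measurableT_comp mf (pair1_measurable x)).
- by move=> s; rewrite (le_trans (fM _))// big_ord_recl /= mulrA.
Qed.

End iter_int.

(** * Scaling and reflection of iterated Lebesgue integrals *)

Section dilation.
Context {R : realType}.
Local Notation T n := (ss_type R (cube n)).
Local Notation mu n := (ss_mu (cube n)).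

(** By uniqueness of Lebesgue measure on half-open intervals: [a] times its image under [x -> a x]
    gives []b, c]] the length [c - b]. *)
Lemma lebesgue_dilation (a : R) (f : R -> \bar R) : 0 < a ->
  measurable_fun setT f -> (forall x, 0 <= f x)%E ->
  (\int[lebesgue_measure]_x f (a * x)%R =
   a^-1%:E * \int[lebesgue_measure]_x f x)%E.
Proof.
move=> a0 mf f0.
have a0' := ltW a0.
pose h := ( *%R a : measurableTypeR R -> measurableTypeR R).
have mh : measurable_fun setT h by exact: measurable_funM.
rewrite -(ge0_integral_pushforward mh lebesgue_measure measurableT mf)//.
pose m := mscale (NngNum a0') (pushforward lebesgue_measure h).
have -> : (\int[lebesgue_measure]_x f x = \int[m mh]_x f x)%E.
  apply: eq_measure_integral => A mA _.
  apply: lebesgue_measure_unique => //= _ [[b c]] _ <-.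
  rewrite /m /mscale /= /pushforward.
  have -> : h @^-1` `]b, c]%classic = `]b / a, c / a]%classic.
    apply/seteqP; split => x /=; rewrite !in_itv/= /h.
      by rewrite ltr_pdivrMr// ler_pdivlMr// mulrC.
    by rewrite ltr_pdivrMr// ler_pdivlMr// mulrC.
  rewrite !lebesgue_measure_itv/= !lte_fin ltr_pM2r ?invr_gt0//.
  case: ifP => _; last by rewrite mule0.
  by rewrite -!EFinB -EFinM -mulrBl mulrCA divff ?mulr1// gt_eqF.
rewrite ge0_integral_mscale//= muleA -EFinM mulVf ?mul1e// gt_eqF//.
Qed.

Lemma lebesgue_reflection (f : R -> \bar R) :
  measurable_fun setT f -> (forall x, 0 <= f x)%E ->
  (\int[lebesgue_measure]_x f (- x)%R = \int[lebesgue_measure]_x f x)%E.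
Proof.
move=> mf f0.
have mN : measurable_fun setT (-%R : measurableTypeR R -> measurableTypeR R).
  exact: oppr_measurable.
rewrite -(ge0_integral_pushforward mN lebesgue_measure measurableT mf)//.
by apply: eq_measure_integral => A mA _; exact: lebesgue_measureN.
Qed.

(** The factor [c] is abstract so that dilations ([c = a^-1]) and the reflection ([a = -1], [c = 1])
    share one induction. *)
Lemma cube_dilation (a c : R) n : 0 <= c ->
  (forall f : R -> \bar R, measurable_fun setT f -> (forall x, 0 <= f x)%E ->
    (\int[lebesgue_measure]_x f (a * x)%R =
     c%:E * \int[lebesgue_measure]_x f x)%E) ->
  exists phi : T n -> T n, [/\ measurable_fun setT phi,
    forall x, ss_seq (phi x) = map ( *%R a) (ss_seq x) &
    forall F : T n -> \bar R, measurable_fun setT F -> (forall x, 0 <= F x)%E ->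
    (\int[mu n]_x F (phi x) = (c ^+ n)%:E * \int[mu n]_x F x)%E].
Proof.
move=> c0 H; elim: n => [|n [phi [mphi phiE intphi]]] /=.
  by exists id; split => // F mF F0; rewrite expr0 mul1e.
pose phi' (x : T n.+1) : T n.+1 := (a * x.1, phi x.2).
have mphi' : measurable_fun setT phi'.
  apply/measurable_fun_pair => /=.
    by apply: measurable_funM.
  exact: measurableT_comp mphi measurable_snd.
exists phi'; split => // [x|F mF F0]; first by rewrite /= phiE.
rewrite !fubini_tonelli1//=; last exact: (measurableT_comp mF mphi').
rewrite /fubini_F /phi' /=.
transitivity (\int[lebesgue_measure]_x ((c ^+ n)%:E * \int[mu n]_y F (a * x, y)%R))%E.
  apply: eq_integral => x _; rewrite -intphi//.
  exact: (measurableT_comp mF (pair1_measurable _)).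
rewrite ge0_integralZl ?lee_fin ?exprn_ge0//.
- rewrite (H (fun x => \int[mu n]_y F (x, y))%E) ?muleA -?EFinM -?exprSr//.
    exact: measurable_fun_fubini_tonelli_F.
  by move=> x; exact: integral_ge0.
- apply: (measurableT_comp (measurable_fun_fubini_tonelli_F _ mF F0)).
  exact: measurable_funM.
- by move=> x _; exact: integral_ge0.
Qed.

End dilation.

(** * Homogeneous functions and balls *)

Section euclid.
Context {R : realType} {p : nat}.
Implicit Types (x y t v : 'rV[R]_p) (a r : R).

Lemma dotpC x y : dotp x y = dotp y x.
Proof. by apply: eq_bigr => i _; rewrite mulrC. Qed.

Lemma dotpDl x y t : dotp (x + y) t = dotp x t + dotp y t.
Proof. by rewrite /dotp -big_split/=; apply: eq_bigr => i _; rewrite mxE mulrDl. Qed.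

Lemma dotpZl a x y : dotp (a *: x) y = a * dotp x y.
Proof. by rewrite /dotp mulr_sumr; apply: eq_bigr => i _; rewrite mxE mulrA. Qed.

Lemma dotpZr a x y : dotp x (a *: y) = a * dotp x y.
Proof. by rewrite dotpC dotpZl dotpC. Qed.

Lemma dotp_delta i : dotp (delta_mx 0 i) (delta_mx 0 i : 'rV[R]_p) = 1.
Proof.
rewrite /dotp (bigD1 i)//= big1 ?addr0 => [|j ij]; first by rewrite !mxE !eqxx mulr1.
by rewrite !mxE (negbTE ij) andbF mulr0.
Qed.

Lemma dotp_ge0 x : 0 <= dotp x x.
Proof. by apply: sumr_ge0 => i _; rewrite -expr2 sqr_ge0. Qed.

Lemma enorm_ge0 x : 0 <= enorm x.
Proof. exact: sqrtr_ge0. Qed.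

Lemma sqr_enorm x : enorm x ^+ 2 = dotp x x.
Proof. by rewrite sqr_sqrtr// dotp_ge0. Qed.

Lemma enormZ a x : enorm (a *: x) = `|a| * enorm x.
Proof.
by rewrite /enorm dotpZl dotpZr mulrA -expr2 sqrtrM ?sqr_ge0// sqrtr_sqr.
Qed.

Lemma ler_coord_enorm x i : `|x 0 i| <= enorm x.
Proof.
rewrite -sqrtr_sqr ler_wsqrtr// /dotp (bigD1 i)//= -expr2 lerDl.
by apply: sumr_ge0 => j _; rewrite -expr2 sqr_ge0.
Qed.

Lemma ler_norm_dotp x y : `|dotp x y| <= (\sum_i `|x 0 i|) * enorm y.
Proof.
rewrite (le_trans (ler_norm_sum _ _ _))// mulr_suml ler_sum// => i _.
by rewrite normrM ler_wpM2l// ler_coord_enorm.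
Qed.

Lemma sqr_enormDZ x v a :
  dotp (x + a *: v) (x + a *: v) =
  dotp x x + a * (2 * dotp x v) + a ^+ 2 * dotp v v.
Proof.
rewrite dotpDl !dotpZl !(dotpC _ (x + _)) !dotpDl !dotpZl (dotpC v x).
by rewrite expr2; ring.
Qed.

End euclid.

Section ball_integral.
Context {R : realType} (p : nat).
Local Notation T := (ss_type R (cube p)).
Local Notation mu := (ss_mu (cube p)).

Definition vec (x : T) : 'rV[R]_p := \row_i nth 0 (ss_seq x) i.

Lemma measurable_dotp_vec t : measurable_fun [set: T] (fun x => dotp t (vec x)).
Proof.
apply: measurable_sum => i; apply: measurable_funM => //.
under eq_fun do rewrite mxE.
exact: measurable_ss_seq.
Qed.

Lemma measurable_enorm_vec : measurable_fun [set: T] (fun x => enorm (vec x)).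
Proof.
have ms := continuous_measurable_fun (@sqrt_continuous R).
apply: (measurableT_comp ms).
apply: measurable_sum => i; under eq_fun do rewrite mxE.
by apply: measurable_funM; exact: measurable_ss_seq.
Qed.

(** The unit ball lies in the cube [[-1, 1]^p], so [M] times a product of indicators of [[-1, 1]]
    dominates [g], as [iter_int_dominatedE] asks. *)
Lemma lebesgue_int_unit_ballE (M : R) (g : 'rV[R]_p -> R) :
  measurable_fun [set: T] (fun x => g (vec x)) ->
  (forall x, `|g x| <= M) -> (forall x, 1 < enorm x -> g x = 0) ->
  mu.-integrable [set: T] (fun x => (g (vec x))%:E) /\
  lebesgue_int (EFin \o g) = (\int[mu]_x (g (vec x))%:E)%E.
Proof.
move=> mg gM g1.
have M0 : 0 <= M by exact: le_trans (gM 0).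
apply: (iter_int_dominatedE p (\1_`[-1, 1] : R -> R) M) => //.
- rewrite integral_indic// setIT.
  rewrite [X in (X < _)%E]lebesgue_measure_itv/= lte_fin; case: ifP; rewrite ?ltry//.
- move=> s /=; set x := \row_i _.
  have [xi|] := pselect (forall i : 'I_p, `|s`_i| <= 1).
    rewrite big1 ?mulr1// => i _; rewrite indicE mem_set//=.
    by rewrite in_itv/= -ler_norml.
  move=> /existsNP[i /negP]; rewrite -ltNge => i1.
  rewrite g1 ?normr0 ?mulr_ge0 ?prodr_ge0//.
  by rewrite (lt_le_trans i1)// (le_trans _ (ler_coord_enorm _ i))// mxE.
Qed.

Lemma integral_vec_scale (a c : R) (g : 'rV[R]_p -> \bar R) : 0 <= c ->
  (forall f : R -> \bar R, measurable_fun setT f -> (forall x, 0 <= f x)%E ->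
    (\int[lebesgue_measure]_x f (a * x)%R =
     c%:E * \int[lebesgue_measure]_x f x)%E) ->
  measurable_fun [set: T] (fun x => g (vec x)) -> (forall x, 0 <= g x)%E ->
  measurable_fun [set: T] (fun x => g (a *: vec x)%R) /\
  (\int[mu]_x g (a *: vec x)%R = (c ^+ p)%:E * \int[mu]_x g (vec x))%E.
Proof.
move=> c0 /(cube_dilation _ _ p c0)[phi [mphi phiE intphi]] mg g0.
have vphi x : a *: vec x = vec (phi x).
  apply/rowP => i; rewrite !mxE phiE.
  have [si|si] := ltnP i (size (ss_seq x)); first by rewrite (nth_map 0).
  (* The default 0 of [nth] is fixed by scaling, so the length of the list need not be known. *)
  by rewrite !nth_default ?size_map// mulr0.
have -> : (fun x => g (a *: vec x)) = (fun x => g (vec (phi x))).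
  by apply/funext => x; rewrite vphi.
split; first exact: (measurableT_comp mg mphi).
by rewrite (intphi (fun x => g (vec x))).
Qed.

Lemma integral_vec_dilation (a : R) (g : 'rV[R]_p -> \bar R) : 0 < a ->
  measurable_fun [set: T] (fun x => g (vec x)) -> (forall x, 0 <= g x)%E ->
  (\int[mu]_x g (a *: vec x)%R = (a ^- p)%:E * \int[mu]_x g (vec x))%E.
Proof.
move=> a0 mg g0; have [||_] := integral_vec_scale a a^-1 g _ _ mg g0.
- by rewrite invr_ge0 ltW.
- by move=> f mf f0; exact: lebesgue_dilation.
- by rewrite exprVn.
Qed.

Lemma integral_vec_opp (g : 'rV[R]_p -> \bar R) :
  measurable_fun [set: T] (fun x => g (vec x)) -> (forall x, 0 <= g x)%E ->
  measurable_fun [set: T] (fun x => g (- vec x)%R) /\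
  (\int[mu]_x g (- vec x)%R = \int[mu]_x g (vec x))%E.
Proof.
move=> mg g0; have [//||] := integral_vec_scale (-1) 1 g _ _ mg g0.
- move=> f mf f0; under eq_integral do rewrite mulN1r.
  by rewrite mul1e lebesgue_reflection.
- have -> : (fun x => g (-1 *: vec x)) = (fun x => g (- vec x)).
    by apply/funext => x; rewrite scaleN1r.
  by rewrite expr1n mul1e.
Qed.

Definition ball_int (r : R) (g : 'rV[R]_p -> R) : \bar R :=
  (\int[mu]_x (if enorm (vec x) <= r then g (vec x) else 0)%:E)%E.

Lemma ball_int_ge0 r g : (forall x, 0 <= g x) -> (0 <= ball_int r g)%E.
Proof. by move=> g0; apply: integral_ge0 => x _; case: ifP; rewrite lee_fin. Qed.

(** Substituting [r y] for [x]: the Jacobian gives [r ^+ p] and homogeneity gives [r ^+ d]. *)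
Lemma ball_int_homogeneous (r : R) d (g : 'rV[R]_p -> R) : 0 < r ->
  measurable_fun [set: T] (fun x => g (vec x)) -> (forall x, 0 <= g x) ->
  (forall a x, 0 < a -> g (a *: x) = a ^+ d * g x) ->
  (ball_int r g = (r ^+ (p + d))%:E * ball_int 1 g)%E.
Proof.
move=> r0 mg g0 gh.
have mb s : measurable_fun [set: T]
    (fun x => (if enorm (vec x) <= s then g (vec x) else 0)%:E).
  apply: measurable_funEFin; apply: measurable_fun_ifT => //.
  by apply: measurable_fun_ler => //; exact: measurable_enorm_vec.
have b0 s x : (0 <= (if enorm x <= s then g x else 0)%:E)%E.
  by rewrite lee_fin; case: ifP.
have := @integral_vec_dilation r (fun x => (if enorm x <= r then g x else 0)%:E)
  r0 (mb r) (b0 r).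
rewrite -/(ball_int r g) => /(congr1 (mule (r ^+ p)%:E)).
rewrite muleA -EFinM divff ?expf_neq0 ?gt_eqF// mul1e => <-.
rewrite exprD EFinM -muleA; congr (_ * _)%E.
rewrite /ball_int -ge0_integralZl ?lee_fin ?exprn_ge0 ?(ltW r0)//.
apply: eq_integral => x _; rewrite enormZ gtr0_norm// -ler_pdivlMl// mulVf ?gt_eqF//.
by case: ifP => _; rewrite ?mule0// gh// -EFinM.
Qed.

(* Integrating [rho u] over the [u] with [|x| <= rad u] writes a radial weight as a
   superposition of balls, on which the integral of [g] is known by scaling. *)
Lemma layer_cake d (rho rad : R -> R) (g : 'rV[R]_p -> R) :
  measurable_fun setT rho -> (forall u, 0 <= rho u) ->
  measurable_fun setT rad -> (forall u, rho u != 0 -> 0 < rad u) ->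
  measurable_fun [set: T] (fun x => g (vec x)) -> (forall x, 0 <= g x) ->
  (forall a x, 0 < a -> g (a *: x) = a ^+ d * g x) ->
  (\int[mu]_x ((g (vec x))%:E *
    \int[lebesgue_measure]_u (if enorm (vec x) <= rad u then rho u else 0)%:E) =
  \int[lebesgue_measure]_u (rho u * rad u ^+ (p + d))%:E * ball_int 1 g)%E.
Proof.
move=> mrho rho0 mrad rad0 mg g0 gh.
pose K (x : T) u := if enorm (vec x) <= rad u then rho u else 0.
have mK : measurable_fun setT (fun z : T * measurableTypeR R => K z.1 z.2).
  apply: measurable_fun_ifT => //.
    apply: measurable_fun_ler.
      exact: (measurableT_comp measurable_enorm_vec measurable_fst).
    exact: (measurableT_comp mrad measurable_snd).
  exact: (measurableT_comp mrho measurable_snd).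
have K0 x u : 0 <= K x u by rewrite /K; case: ifP.
pose F (z : T * measurableTypeR R) := (g (vec z.1) * K z.1 z.2)%:E.
have mF : measurable_fun setT F.
  apply: measurable_funEFin; apply: measurable_funM => //.
  exact: (measurableT_comp mg measurable_fst).
have F0 z : (0 <= F z)%E by rewrite lee_fin mulr_ge0.
transitivity (\int[mu]_x \int[lebesgue_measure]_u F (x, u))%E.
  apply: eq_integral => x _; rewrite -ge0_integralZl ?lee_fin//.
    by apply: measurable_funEFin; exact: (measurableT_comp mK (pair1_measurable x)).
  by move=> u _; rewrite lee_fin; exact: K0.
rewrite fubini_tonelli// -ge0_integralZr ?ball_int_ge0//; last 2 first.
- apply: measurable_funEFin; apply: measurable_funM => //.
  exact: measurable_funX.
- move=> u _; rewrite lee_fin; have [->|/rad0 r0] := eqVneq (rho u) 0.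
    by rewrite mul0r.
  by rewrite mulr_ge0// exprn_ge0 ?ltW.
(* Where [rho] vanishes, [rad] may be nonpositive and scaling does not apply, but both sides are
   0. *)
apply: eq_integral => u _; have [ru0|ru0] := eqVneq (rho u) 0.
  rewrite ru0 mul0r mul0e; apply: integral0_eq => x _.
  by rewrite /F /K ru0 if_same mulr0.
rewrite EFinM -muleA -ball_int_homogeneous ?rad0// /ball_int -ge0_integralZl ?lee_fin//.
- apply: eq_integral => x _; rewrite /F /K/= -EFinM.
  by case: ifP => _; rewrite ?mulr0// mulrC.
- apply: measurable_funEFin; apply: measurable_fun_ifT => //.
  by apply: measurable_fun_ler => //; exact: measurable_enorm_vec.
- by move=> x _; rewrite lee_fin; case: ifP.
Qed.

End ball_integral.

(** * Gamma and Gaussian integrals on the line *)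

Section real_integrals.
Context {R : realType}.
Implicit Types (a b q s : R).

Lemma integral_if (P : pred R) (f : R -> R) :
  (\int[lebesgue_measure]_x (if P x then f x else 0)%:E =
   \int[lebesgue_measure]_(x in [set x | P x]) (f x)%:E)%E.
Proof.
rewrite [RHS]integral_mkcond; apply: eq_integral => x _; rewrite patchE.
by case: ifPn => Px; [rewrite mem_set|rewrite memNset//=; exact/negP].
Qed.

Lemma continuous_powR q a : 0 < a -> {for a, continuous (@powR R ^~ q)}.
Proof.
move=> a0; apply: differentiable_continuous; apply/derivable1_diffP.
by apply: derivable_powR; rewrite in_itv/= a0.
Qed.

Lemma powR_cvg_at_right q a : 0 < q -> 0 <= a ->
  x `^ q @[x --> a^'+] --> a `^ q.
Proof.
move=> q0; rewrite le_eqVlt => /predU1P[<-|a0].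
  by rewrite powR0 ?gt_eqF//; exact: powR_cvg0.
by apply: cvg_at_right_filter; exact: continuous_powR.
Qed.

(** The bound [1 < s] keeps the integrand continuous up to 0, so the fundamental theorem of calculus
    applies even for [a = 0]. *)
Lemma integral_powR s a b : 1 < s -> 0 <= a -> a <= b ->
  (\int[lebesgue_measure]_(u in `[a, b]) (s * u `^ (s - 1))%:E =
   (b `^ s - a `^ s)%:E)%E.
Proof.
move=> s1 a0; rewrite le_eqVlt => /predU1P[<-|ab].
  by rewrite set_itv1 integral_set1 subrr.
have b0 : 0 < b by exact: le_lt_trans ab.
have s0 : 0 < s by exact: lt_trans s1.
have s10 : 0 < s - 1 by rewrite subr_gt0.
have in0 x : x \in `]a, b[%R -> 0 < x.
  by rewrite in_itv/= => /andP[ax _]; exact: le_lt_trans ax.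
rewrite (@continuous_FTC2 R _ (@powR R ^~ s))//.
- apply/continuous_within_itvP => //; split.
  + by move=> x /in0 x0; apply: cvgM; [exact: cvg_cst|exact: continuous_powR].
  + by apply: cvgM; [exact: cvg_cst|exact: powR_cvg_at_right].
  + apply: cvgM; first exact: cvg_cst.
    by apply: cvg_at_left_filter; exact: continuous_powR.
- split.
  + by move=> x /in0 x0; apply: derivable_powR; rewrite in_itv/= x0.
  + exact: powR_cvg_at_right.
  + by apply: cvg_at_left_filter; exact: continuous_powR.
- by move=> x /in0 x0; rewrite powR_derive1// in_itv/= x0.
Qed.

Lemma integral_expRN a :
  (\int[lebesgue_measure]_(u in `[a, +oo[) (expR (- u))%:E = (expR (- a))%:E)%E.
Proof.
have cN : continuous (fun x : R => expR (- x)).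
  move=> x; apply: continuous_comp; last exact: continuous_expR.
  exact: oppr_continuous.
rewrite (@ge0_continuous_FTC2y R _ (fun x => - expR (- x)) _ 0)//.
- by rewrite EFinN oppeK add0e.
- exact: continuous_subspaceT.
- by rewrite -oppr0; apply: cvgN; exact: cvgr_expR.
- by apply: cvgN; apply: cvg_at_right_filter; exact: cN.
- move=> x _; rewrite derive1E derive_val.
  by rewrite mulrN1 opprK.
Qed.

(** The guard [0 < u] matches the domain of [Gamma]; it changes the half-line only for [a = 0], and
    then by a single point. *)
Lemma integral_expRN_tail a : 0 <= a ->
  (\int[lebesgue_measure]_u (if (0 < u) && (a <= u) then expR (- u) else 0)%:E =
   (expR (- a))%:E)%E.
Proof.
have mexp (D : set R) : measurable_fun D (fun u => (expR (- u))%:E).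
  apply: measurable_funTS; apply: measurable_funEFin.
  exact: measurableT_comp.
rewrite integral_if -integral_expRN le_eqVlt => /predU1P[<-|a0].
  rewrite -integral_itv_obnd_cbnd//; congr (integral _ _ _).
  apply/seteqP; split=> x/=; rewrite in_itv/= andbT; first by case/andP.
  by move=> /[dup]x0 /ltW ->; rewrite x0.
congr (integral _ _ _); apply/seteqP; split=> x/=; rewrite in_itv/= andbT.
  by case/andP.
by move=> ax; rewrite ax (lt_le_trans a0 ax).
Qed.

(* [Gamma] before [fine], which would send a divergent integral to 0. *)
Definition Gammae s : \bar R :=
  (\int[lebesgue_measure]_u (if (0 < u)%R then u `^ (s - 1) * expR (- u) else 0)%:E)%E.

Lemma GammaE s : Gamma s = fine (Gammae s).
Proof. by rewrite /Gammae integral_if. Qed.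

(** In place of an integration by parts, [t^s] is written as the integral of [s u^(s-1)] over
    [[0, t]]; after Tonelli the integral in [t] is the tail [e^-u]. The identity holds in [\bar R],
    with no prior finiteness. *)
Lemma Gammae_recurrence s : 1 < s -> (Gammae (s + 1) = s%:E * Gammae s)%E.
Proof.
move=> s1; have s0 : 0 < s by exact: lt_trans s1.
pose K (t u : measurableTypeR R) : R :=
  if (0 < t) && (0 <= u) && (u <= t) then expR (- t) * (s * u `^ (s - 1)) else 0.
have mf : measurable_fun setT (@fst (measurableTypeR R) (measurableTypeR R)).
  exact: measurable_fst.
have ms : measurable_fun setT (@snd (measurableTypeR R) (measurableTypeR R)).
  exact: measurable_snd.
have mexp : measurable_fun setT (fun t : R => expR (- t)) by exact: measurableT_comp.
have mpow : measurable_fun setT (fun t : R => s * t `^ (s - 1)).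
  by apply: measurable_funM => //; exact: measurable_powR.
have mK : measurable_fun setT
    (fun z : measurableTypeR R * measurableTypeR R => K z.1 z.2).
  apply: measurable_fun_ifT => //.
    apply: measurable_and; last exact: measurable_fun_ler.
    apply: measurable_and.
      exact: measurable_fun_ltr.
    exact: measurable_fun_ler.
  apply: measurable_funM; first exact: (measurableT_comp mexp mf).
  exact: (measurableT_comp mpow ms).
have K0 t u : 0 <= K t u.
  by rewrite /K; case: ifP => // _; rewrite !mulr_ge0 ?expR_ge0 ?powR_ge0// ltW.
transitivity (\int[lebesgue_measure]_t \int[lebesgue_measure]_u (K t u)%:E)%E.
  apply: eq_integral => t _; rewrite /K; case: ifPn => t0/=; last first.
    by rewrite integral0.
  under eq_integral.
    move=> u _.
    rewrite (_ : (if _ then _ else _) = expR (- t) *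
       (if (0 <= u) && (u <= t) then s * u `^ (s - 1) else 0)); last first.
      by case: ifP; rewrite ?mulr0.
    rewrite EFinM; over.
  rewrite ge0_integralZl ?lee_fin ?expR_ge0//; last 2 first.
  - apply: measurable_funEFin; apply: measurable_fun_ifT => //.
    by apply: measurable_and; exact: measurable_fun_ler.
  - by move=> u _; rewrite lee_fin; case: ifP => // _; rewrite mulr_ge0 ?powR_ge0// ltW.
  rewrite (integral_if (fun u => (0 <= u) && (u <= t))).
  have -> : [set u | (0 <= u) && (u <= t)] = `[0, t]%classic.
    by apply/seteqP; split=> u/=; rewrite in_itv.
  rewrite (integral_powR s 0 t s1 (lexx 0) (ltW t0)).
  rewrite powR0 ?gt_eqF// subr0.
  by rewrite -EFinM mulrC addrK.
rewrite (fubini_tonelli (fun z => (K z.1 z.2)%:E)); last 2 first.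
- exact: measurable_funEFin.
- by move=> z; rewrite lee_fin.
rewrite /Gammae -ge0_integralZl ?lee_fin ?(ltW s0)//; last 2 first.
- apply: measurable_funEFin; apply: measurable_fun_ifT => //.
    exact: measurable_fun_ltr.
  by apply: measurable_funM => //; exact: measurable_powR.
- by move=> u _; rewrite lee_fin; case: ifP => // _; rewrite mulr_ge0 ?powR_ge0 ?expR_ge0.
apply: eq_integral => u _; rewrite /K/=; have [u0|u0] := ltP 0 u; last first.
  rewrite mule0; apply: integral0_eq => t _; case: ifP => // /andP[/andP[t0 u0'] _].
  have /eqP u00 : (u : R) == 0 by rewrite eq_le u0.
  have -> : (u : R) `^ (s - 1) = 0 by rewrite u00 powR0// gt_eqF// subr_gt0.
  by rewrite !mulr0.
under eq_integral.
  move=> t _.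
  rewrite (_ : (if _ then _ else _) = (s * u `^ (s - 1)) *
     (if (0 < t) && (u <= t) then expR (- t) else 0)); last first.
    by rewrite (ltW u0) andbT; case: ifP; rewrite ?mulr0// mulrC.
  rewrite EFinM; over.
rewrite ge0_integralZl ?lee_fin ?mulr_ge0 ?powR_ge0 ?(ltW s0)//; last 2 first.
- apply: measurable_funEFin; apply: measurable_fun_ifT => //.
  by apply: measurable_and; [exact: measurable_fun_ltr|exact: measurable_fun_ler].
- by move=> t _; rewrite lee_fin; case: ifP => // _; rewrite expR_ge0.
by rewrite integral_expRN_tail ?(ltW u0)// -!EFinM mulrA.
Qed.

(** Completing the square: the integrand is a constant multiple of the normal density of mean [t]
    and variance 1. *)
Lemma integral_gaussian_mgf (t : R) :
  (\int[lebesgue_measure]_x (expR (t * x - x ^+ 2 / 2))%:E =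
   (Num.sqrt (2 * pi) * expR (t ^+ 2 / 2))%:E)%E.
Proof.
pose c : R := Num.sqrt (2 * pi) * expR (t ^+ 2 / 2).
have c0 : 0 <= c by rewrite mulr_ge0 ?sqrtr_ge0 ?expR_ge0.
have pi2 : 0 < Num.sqrt (pi *+ 2) :> R by rewrite sqrtr_gt0 mulrn_wgt0 ?pi_gt0.
under eq_integral.
  move=> x _.
  rewrite (_ : expR _ = c * normal_pdf t 1 x); last first.
    rewrite normal_pdfE ?oner_neq0// /normal_peak /normal_fun expr1n mul1r /c mulr_natl.
    rewrite mulrACA divff ?gt_eqF// mul1r -expRD; congr expR.
    by field.
  rewrite EFinM; over.
rewrite ge0_integralZl//.
- by rewrite integral_normal_pdf mule1.
- by apply: measurable_funEFin; exact: measurable_normal_pdf.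
- by move=> x _; rewrite lee_fin normal_pdf_ge0.
Qed.

End real_integrals.

(** * Entire power series *)

Section entire_pseries.
Context {R : realType}.
Implicit Types (c : R^nat) (z : R).

Lemma pseriesS c z n :
  pseries c z n.+1 = c 0%N + z * pseries (fun k => c k.+1) z n.
Proof.
rewrite /pseries !seriesEnat/= big_nat_recl// expr0 mulr1 mulr_sumr; congr (_ + _).
by apply: eq_bigr => k _; rewrite exprS mulrCA.
Qed.

Lemma cvg_pseries_shift c : (forall z, cvgn (pseries c z)) ->
  forall z, cvgn (pseries (fun k => c k.+1) z).
Proof.
move=> cc z; have [->|z0] := eqVneq z 0.
  apply/cvg_ex; exists (c 1%N); rewrite -cvg_shiftS.
  under eq_fun do rewrite pseriesS mul0r addr0.
  exact: cvg_cst.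
have -> : pseries (fun k => c k.+1) z =
    (fun n => z^-1 * (pseries c z n.+1 - c 0%N)).
  by apply/funext => n; rewrite pseriesS addrC addKr mulKf.
apply: is_cvgM; first exact: is_cvg_cst.
apply: is_cvgB; last exact: is_cvg_cst.
have /cvg_ex[l cl] := cc z.
by apply/cvg_ex; exists l; rewrite (cvg_shiftS (pseries c z)).
Qed.

(** The extra factor [n + 1] is at most [2 ^ n], so the shifted series at [2 |z|] dominates; it
    converges absolutely because it converges at a larger radius. *)
Lemma cvg_pseries_diffs c : (forall z, cvgn (pseries c z)) ->
  forall z, cvgn (pseries (pseries_diffs c) z).
Proof.
move=> /cvg_pseries_shift cc z.
pose X := 2 * `|z|.
have X0 : 0 <= X by rewrite mulr_ge0.
have /(is_cvg_pseries_inside_norm (cc (X + 1))) cX : `|X| < `|X + 1|.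
  by rewrite !ger0_norm ?addr_ge0// ltrDl.
apply: normed_cvg; apply: series_le_cvg cX => n //=.
  by rewrite mulr_ge0// exprn_ge0.
rewrite /pseries_diffs !normrM normrX ger0_norm// /X exprMn.
rewrite -mulrA mulrCA ler_wpM2l// ler_wpM2r ?exprn_ge0//.
by rewrite -natrX ler_nat ltn_expl.
Qed.

Lemma is_derive_pseries c : (forall z, cvgn (pseries c z)) -> forall z,
  is_derive z (1 : R) (fun x => limn (pseries c x)) (limn (pseries (pseries_diffs c) z)).
Proof.
move=> cc z; have cd := cvg_pseries_diffs c cc.
apply: (@pseries_snd_diffs _ _ (`|z| + 1)) => //.
  exact: cvg_pseries_diffs cd _.
by rewrite [ltRHS]ger0_norm ?addr_ge0// ltrDl.
Qed.

(** By continuity from the right, a sum vanishing on the positive axis vanishes at 0, where its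
    value is the constant term. *)
Lemma pseries_coef0 c : (forall z, cvgn (pseries c z)) ->
  (forall z, 0 < z -> limn (pseries c z) = 0) -> c 0%N = 0.
Proof.
move=> cc c0.
have <- : limn (pseries c 0) = c 0%N.
  apply/cvg_lim => //; rewrite -cvg_shiftS.
  under eq_fun do rewrite pseriesS mul0r addr0.
  exact: cvg_cst.
have cont : {for 0, continuous (fun x => limn (pseries c x))}.
  apply: differentiable_continuous; apply/derivable1_diffP.
  by have [] := is_derive_pseries c cc 0.
have /cvg_at_right_filter/cvg_lim <- // := cont.
apply/cvg_lim => //; apply: (@cvg_trans _ ((fun=> 0) @ 0^'+)); last exact: cvg_cst.
apply: near_eq_cvg; near=> z; rewrite c0//.
Unshelve. all: by end_near. Qed.

(** Once the constant term is gone, dividing by [z] gives the shifted series, still zero on the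
    positive axis. *)
Lemma pseries_eq0 c : (forall z, cvgn (pseries c z)) ->
  (forall z, 0 < z -> limn (pseries c z) = 0) -> forall n, c n = 0.
Proof.
move=> + + n; elim: n c => [|n IH] c cc c0; first exact: pseries_coef0.
have cs := cvg_pseries_shift c cc.
apply: (IH (fun k => c k.+1)) => // z z0.
have : pseries c z n @[n --> \oo] --> (0 : R) by rewrite -(c0 z z0); exact: cc.
rewrite -cvg_shiftS; under eq_fun do rewrite pseriesS pseries_coef0// add0r.
move=> cz; apply/cvg_lim => //.
have -> : pseries (fun k => c k.+1) z =
    (fun n => z^-1 * (z * pseries (fun k => c k.+1) z n)).
  by apply/funext => m; rewrite mulKf// gt_eqF.
by rewrite -(mulr0 z^-1); apply: cvgM => //; exact: cvg_cst.
Qed.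

Lemma pseries_inj a b : (forall z, cvgn (pseries a z)) ->
  (forall z, cvgn (pseries b z)) ->
  (forall z, 0 < z -> limn (pseries a z) = limn (pseries b z)) -> a =1 b.
Proof.
move=> ca cb ab n; apply/eqP; rewrite -subr_eq0; apply/eqP.
have E z : pseries (fun k => a k - b k) z = pseries a z - pseries b z.
  apply/funext => m; rewrite /pseries !fctE !seriesEnat/= -sumrB.
  by apply: eq_bigr => k _; rewrite mulrBl.
apply: (pseries_eq0 (fun k => a k - b k)) => [z|z z0]; rewrite E.
  exact: is_cvgB.
by rewrite limB// ab// subrr.
Qed.

End entire_pseries.

(** * The even part of the exponential series *)

Section cosh.
Context {R : realType}.

(** Its series has only even powers, hence nonnegative terms, and may be integrated termwise by
    monotone convergence. *)
Definition cosh (x : R) : R := (expR x + expR (- x)) / 2.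

(** The odd terms of the two exponential series cancel, so the partial sums are the mean of theirs
    taken at even lengths. *)
Lemma cvg_cosh (x : R) :
  series (fun j => x ^+ (2 * j) / (2 * j)`!%:R) n @[n --> \oo] --> cosh x.
Proof.
pose s : R^nat := fun n => (series (exp_coeff x) n + series (exp_coeff (- x)) n) / 2.
have scvg : s n @[n --> \oo] --> cosh x.
  apply: cvgM; last exact: cvg_cst.
  by apply: cvgD; exact: is_cvg_series_exp_coeff.
have -> : series (fun j => x ^+ (2 * j) / (2 * j)`!%:R) = s \o muln^~ 2%N.
  apply/funext; elim=> [|n IH].
    by rewrite /s /= !seriesEnat/= !big_geq// addr0 mul0r.
  have ser2 (u : R^nat) :
      series u (n.+1 * 2)%N = series u (n * 2)%N + u (n * 2)%N + u (n * 2).+1.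
    by rewrite mulSn !addSn add0n !seriesSr.
  have even : exp_coeff (- x) (n * 2) = exp_coeff x (n * 2).
    by rewrite /exp_coeff/= exprNn -signr_odd oddM andbF mul1r.
  have odd : exp_coeff (- x) (n * 2).+1 = - exp_coeff x (n * 2).+1.
    by rewrite /exp_coeff/= exprNn -signr_odd/= oddM andbF mulN1r mulNr.
  rewrite seriesSr IH mulnC /s [LHS]/= [RHS]/= !ser2 even odd.
  by rewrite -[x ^+ _ / _]/(exp_coeff x (n * 2)); field.
apply: (@cvg_comp _ _ _ (muln^~ 2%N) s _ eventually); last exact: scvg.
exact: (cvg_mulnr 2).
Qed.

End cosh.

(** * Gaussian moments *)

Section nneseries_real.
Context {R : realType}.

Lemma nneseries_EFinP (a : R^nat) (l : R) : (forall n, 0 <= a n) ->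
  (\sum_(n <oo) (a n)%:E = l%:E)%E <-> series a n @[n --> \oo] --> l.
Proof.
move=> a0; have sE : (fun n => \sum_(0 <= i < n) (a i)%:E)%E = EFin \o series a.
  by apply/funext => n; rewrite /= sumEFin.
split=> [al|al].
  have ca : cvgn (series a) by apply: nnseries_is_cvg => //; rewrite al ltry.
  have : (limn (EFin \o series a) = l%:E)%E by rewrite -sE.
  by rewrite EFin_lim// => -[<-].
by rewrite sE; apply/cvg_lim => //; exact: cvg_comp al _.
Qed.

End nneseries_real.

Section gaussian_moments.
Context {R : realType} (p : nat).
Hypothesis p_gt0 : (0 < p)%N.
Local Notation T := (ss_type R (cube p)).
Local Notation mu := (ss_mu (cube p)).
Local Notation vec := (@vec R p).
Implicit Types t : 'rV[R]_p.
Local Notation K := (Num.sqrt (2 * pi) ^+ p : R).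

Lemma gaussian_mass_gt0 : 0 < K.
Proof. by rewrite exprn_gt0// sqrtr_gt0 mulr_gt0 ?pi_gt0. Qed.

(** The indicator of the origin is a product of indicators of [{0}] on the line, each of integral 0,
    and [p_gt0] provides at least one factor. *)
Lemma integral_vec0 : (\int[mu]_x (enorm (vec x) == 0)%:R%:E = 0 :> \bar R)%E.
Proof.
have mI : measurable_fun setT (\1_[set 0] : R -> R) by exact: measurable_indic.
transitivity (iter_int p (fun s : seq R => (\prod_(i < p) \1_[set 0] (nth 0 s i))%:E)).
  rewrite iter_int_ge0E.
  - apply: eq_integral => x _; congr EFin.
    have [x0|] := eqVneq (enorm (vec x)) 0.
      rewrite big1// => i _; rewrite indicE mem_set//=.
      have := ler_coord_enorm (vec x) i.
      by rewrite x0 mxE normr_le0 => /eqP.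
    rewrite -sqrf_eq0 sqr_enorm => x0.
    have [[i xi]|x00] := pselect (exists i : 'I_p, vec x 0 i != 0).
      rewrite mxE in xi.
      rewrite (bigD1 i)//= indicE memNset ?mul0r//=.
      exact/eqP.
    case/eqP: x0; rewrite /dotp big1// => i _.
    have [->|xi] := eqVneq (vec x 0 i) 0; first by rewrite mul0r.
    by exfalso; apply: x00; exists i.
  - apply: measurable_funEFin; apply: measurable_prod => i _.
    exact: (measurableT_comp mI (measurable_ss_seq p i)).
  - by move=> s; rewrite lee_fin prodr_ge0.
rewrite (iter_int_prod _ (fun=> \1_[set 0]))//.
rewrite (bigD1 (Ordinal p_gt0))//= integral_indic// setIT.
by rewrite [X in (X * _)%E]lebesgue_measure_set1 mul0e.
Qed.

Definition gauss (x : T) : R := expR (- (enorm (vec x) ^+ 2 / 2)).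

Lemma measurable_gauss : measurable_fun setT gauss.
Proof.
apply: measurableT_comp => //; apply: measurableT_comp => //.
by apply: measurable_funM => //; apply: measurable_funX; exact: measurable_enorm_vec.
Qed.

Lemma gaussian_mgf t :
  (\int[mu]_x (gauss x * expR (dotp t (vec x)))%:E =
   (K * expR (dotp t t / 2))%:E)%E.
Proof.
(* Extends the coordinates of [t] by 0, since [iter_int_prod] takes factors indexed by [nat]. *)
pose tau (i : nat) : R := if insub i is Some j then t 0 j else 0.
have tauE (i : 'I_p) : tau i = t 0 i by rewrite /tau valK.
pose h (i : nat) (x : R) := expR (tau i * x - x ^+ 2 / 2).
have mh i : measurable_fun setT (h i).
  apply: measurableT_comp => //; apply: measurable_funB; first exact: measurable_funM.
  by apply: measurable_funM => //; exact: measurable_funX.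
transitivity (iter_int p (fun s => (\prod_(i < p) h i (nth 0 s i))%:E)).
  rewrite iter_int_ge0E.
  - apply: eq_integral => x _; congr EFin.
    rewrite /gauss sqr_enorm -expRD -expR_sum; congr expR.
    rewrite addrC /dotp mulr_suml -sumrB; apply: eq_bigr => i _.
    by rewrite !mxE tauE expr2.
  - apply: measurable_funEFin; apply: measurable_prod => i _.
    exact: (measurableT_comp (mh i) (measurable_ss_seq p i)).
  - by move=> s; rewrite lee_fin prodr_ge0// => i _; rewrite expR_ge0.
rewrite iter_int_prod//; last by move=> i x; rewrite expR_ge0.
under eq_bigr do rewrite integral_gaussian_mgf tauE.
rewrite prodEFin; congr EFin.
rewrite big_split/= prodr_const card_ord -expR_sum; congr (_ * expR _).
by rewrite /dotp mulr_suml; apply: eq_bigr => i _; rewrite expr2.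
Qed.

Lemma integral_cosh d (U : measurableType d) (m : {measure set U -> \bar R})
    (w u : U -> R) :
  measurable_fun setT w -> measurable_fun setT u -> (forall x, 0 <= w x) ->
  (\int[m]_x (w x * cosh (u x))%:E =
   \sum_(j <oo) ((2 * j)`!%:R^-1%:E * \int[m]_x (w x * u x ^+ (2 * j))%:E))%E.
Proof.
move=> mw mu_ w0.
have wu0 j x : 0 <= w x * u x ^+ (2 * j).
  by rewrite mulr_ge0// exprM exprn_ge0// sqr_ge0.
have f0 j : 0 <= (2 * j)`!%:R^-1 :> R by rewrite invr_ge0.
have mwu j : measurable_fun setT (fun x => (w x * u x ^+ (2 * j))%:E).
  by apply: measurable_funEFin; apply: measurable_funM => //; exact: measurable_funX.
transitivity (\int[m]_x \sum_(j <oo) ((2 * j)`!%:R^-1%:E * (w x * u x ^+ (2 * j))%:E))%E.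
  apply: eq_integral => x _; apply/esym.
  apply/(nneseries_EFinP (fun j => (2 * j)`!%:R^-1 * (w x * u x ^+ (2 * j)))).
    by move=> j; rewrite mulr_ge0.
  have -> : series (fun j => (2 * j)`!%:R^-1 * (w x * u x ^+ (2 * j))) =
      (fun n => w x * series (fun j => u x ^+ (2 * j) / (2 * j)`!%:R) n).
    apply/funext => n; rewrite !seriesEnat/= mulr_sumr.
    by apply: eq_bigr => j _; rewrite mulrC -mulrA.
  by apply: cvgM; [exact: cvg_cst|exact: cvg_cosh].
rewrite integral_nneseries//.
- apply: eq_eseriesr => j _; rewrite ge0_integralZl ?lee_fin//.
  by move=> x _; rewrite lee_fin.
- by move=> j; exact: measurable_funeM.
- by move=> j x _; rewrite -EFinM lee_fin mulr_ge0.
Qed.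

Definition gauss_moment t j : \bar R :=
  (\int[mu]_x (gauss x * dotp t (vec x) ^+ (2 * j))%:E)%E.

Lemma gauss_moment_ge0 t j : (0 <= gauss_moment t j)%E.
Proof.
apply: integral_ge0 => x _.
by rewrite lee_fin mulr_ge0 ?expR_ge0// exprM exprn_ge0// sqr_ge0.
Qed.

(** Replacing [t] by [s *: t] makes the even moments, up to factorials, the coefficients of a power
    series in [s ^+ 2], to be compared with the exponential series. *)
Lemma gaussian_cosh t (s : R) :
  (\sum_(j <oo) ((s ^+ (2 * j) / (2 * j)`!%:R)%:E * gauss_moment t j) =
   (K * expR (s ^+ 2 * (dotp t t / 2)))%:E)%E.
Proof.
have mdot := measurable_dotp_vec p t.
have mg := measurable_gauss.
have mexp (v : 'rV[R]_p) : measurable_fun setT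
    (fun x => (gauss x * expR (dotp v (vec x)))%:E).
  apply: measurable_funEFin; apply: measurable_funM => //.
  by apply: measurableT_comp => //; exact: measurable_dotp_vec.
transitivity (\int[mu]_x (gauss x * cosh (s * dotp t (vec x)))%:E)%E.
  rewrite integral_cosh//; last 2 first.
  - exact: measurable_funM.
  - by move=> x; exact: expR_ge0.
  apply: eq_eseriesr => j _; rewrite mulrC EFinM -muleA; congr (_ * _)%E.
  rewrite /gauss_moment -ge0_integralZl ?lee_fin.
  - by apply: eq_integral => x _; rewrite -EFinM exprMn mulrCA.
  - by [].
  - by apply: measurable_funEFin; apply: measurable_funM => //; exact: measurable_funX.
  - by move=> x _; rewrite lee_fin mulr_ge0 ?expR_ge0// exprM exprn_ge0// sqr_ge0.
  - by rewrite exprM exprn_ge0// sqr_ge0.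
transitivity (2^-1%:E * (\int[mu]_x (gauss x * expR (dotp (s *: t) (vec x)))%:E +
    \int[mu]_x (gauss x * expR (dotp (- s *: t) (vec x)))%:E))%E.
  rewrite -ge0_integralD//; last 2 first.
  - by move=> x _; rewrite lee_fin mulr_ge0 ?expR_ge0.
  - by move=> x _; rewrite lee_fin mulr_ge0 ?expR_ge0.
  rewrite -ge0_integralZl//; last 2 first.
  - exact: emeasurable_funD.
  - by move=> x _; rewrite lee_fin addr_ge0// mulr_ge0 ?expR_ge0.
  apply: eq_integral => x _; rewrite -EFinD -EFinM /cosh !dotpZl mulNr; congr EFin.
  by ring.
rewrite !gaussian_mgf !dotpZl !dotpZr -EFinD -EFinM; congr EFin.
have -> : - s * (- s * dotp t t) = s * (s * dotp t t) by ring.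
by rewrite mulrA -expr2 mulrA; field.
Qed.

Lemma gauss_momentE t j :
  gauss_moment t j =
  (K * (2 * j)`!%:R / j`!%:R * (dotp t t / 2) ^+ j)%:E.
Proof.
have fE n : 0 < (n`!)%:R :> R by rewrite ltr0n fact_gt0.
(* An infinite moment would make the nonnegative series of [gaussian_cosh] at [s = 1] infinite. *)
have fin n : gauss_moment t n \is a fin_num.
  rewrite ge0_fin_numE ?gauss_moment_ge0// ltey; apply/eqP => noo.
  have := gaussian_cosh t 1; rewrite (@eseries_pinfty _ _ _ n)//.
  - move=> k _; rewrite gt_eqF// (lt_le_trans ltNy0)//.
    by rewrite mule_ge0 ?gauss_moment_ge0// lee_fin divr_ge0// exprn_ge0.
  - by rewrite noo gt0_muley// lte_fin divr_gt0// exprn_gt0.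
pose a n : R := fine (gauss_moment t n) / (2 * n)`!%:R.
pose b n : R := K * ((dotp t t / 2) ^+ n / n`!%:R).
have a0 n : 0 <= a n by rewrite divr_ge0// fine_ge0// gauss_moment_ge0.
(* Here [y] stands for [s ^+ 2], so the sum is known only for [0 <= y]; agreement there still
   determines the coefficients. *)
have sa y : 0 <= y -> pseries a y n @[n --> \oo] --> K * expR (y * (dotp t t / 2)).
  move=> y0; apply/nneseries_EFinP => [n|].
    by rewrite mulr_ge0// exprn_ge0.
  rewrite -{2}(sqr_sqrtr y0) -gaussian_cosh; apply: eq_eseriesr => n _.
  rewrite -[in RHS](fineK (fin n)) -EFinM exprM sqr_sqrtr// /a; congr EFin.
  by rewrite /= mulrC mulrA [RHS]mulrAC.
have sb y : pseries b y n @[n --> \oo] --> K * expR (y * (dotp t t / 2)).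
  have -> : pseries b y = fun n => K * series (exp_coeff (y * (dotp t t / 2))) n.
    apply/funext => n; rewrite /pseries !seriesEnat/= mulr_sumr.
    apply: eq_bigr => k _; rewrite /exp_coeff/= exprMn /b.
    by rewrite -mulrA; congr (_ * _); rewrite mulrC mulrA.
  by apply: cvgM; [exact: cvg_cst|exact: is_cvg_series_exp_coeff].
have ab : a =1 b.
  apply: pseries_inj.
  - move=> z; apply: (@is_cvg_pseries_inside _ _ (`|z| + 1)).
      by apply/cvg_ex; eexists; apply: sa; rewrite addr_ge0.
    by rewrite [ltRHS]ger0_norm ?addr_ge0// ltrDl.
  - by move=> z; apply/cvg_ex; eexists; exact: sb.
  - by move=> z /ltW z0; rewrite (cvg_lim _ (sa z z0))// (cvg_lim _ (sb z)).
rewrite -(fineK (fin j)); congr EFin.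
have := congr1 (fun z => z * (2 * j)`!%:R) (ab j).
rewrite /a /b divfK ?gt_eqF// => ->.
by rewrite -!mulrA; congr (_ * _); rewrite mulrC -mulrA mulrCA.
Qed.

End gaussian_moments.

(** * Moments of the ball and of the sphere *)

Section sphere_moments.
Context {R : realType} (p : nat).
Hypothesis p_gt0 : (0 < p)%N.
Local Notation T := (ss_type R (cube p)).
Local Notation mu := (ss_mu (cube p)).
Local Notation vec := (@vec R p).
Local Notation ball_int := (@ball_int R p).
Implicit Types (t : 'rV[R]_p) (j : nat).
Local Notation K := (Num.sqrt (2 * pi) ^+ p : R).
Local Notation nu j := (p%:R / 2 + j%:R : R).

Definition dirn (x : 'rV[R]_p) : 'rV[R]_p := (enorm x)^-1 *: x.

Lemma dotp_dirn t x : dotp t (dirn x) = (enorm x)^-1 * dotp t x.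
Proof. exact: dotpZr. Qed.

Lemma dirnZ a x : 0 < a -> dirn (a *: x) = dirn x.
Proof.
move=> a0; rewrite /dirn enormZ gtr0_norm// scalerA invfM.
by rewrite mulrAC mulVf ?gt_eqF// mul1r.
Qed.

Lemma ler_norm_dotp_dirn t x : `|dotp t (dirn x)| <= \sum_i `|t 0 i|.
Proof.
rewrite (le_trans (ler_norm_dotp _ _))// ler_piMr ?sumr_ge0//.
rewrite enormZ normfV ger0_norm ?enorm_ge0//.
have [->|x0] := eqVneq (enorm x) 0; first by rewrite mulr0.
by rewrite mulVf.
Qed.

Lemma measurable_dotp_dirn t : measurable_fun [set: T] (fun x => dotp t (dirn (vec x))).
Proof.
under eq_fun do rewrite dotp_dirn -powR_inv1 ?enorm_ge0//.
apply: measurable_funM; last exact: measurable_dotp_vec.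
exact: (measurableT_comp (measurable_powR (-1)) (measurable_enorm_vec p)).
Qed.

Definition ball_moment t j : \bar R := ball_int 1 (fun x => dotp t x ^+ (2 * j)).
(** Constancy along rays makes [p] times this ball integral the moment over the sphere, up to the
    null origin, where [dirn] is 0. *)
Definition sphere_moment t j : \bar R :=
  ball_int 1 (fun x => dotp t (dirn x) ^+ (2 * j)).

Lemma even_exprn_ge0 (x : R) j : 0 <= x ^+ (2 * j).
Proof. by rewrite exprM exprn_ge0// sqr_ge0. Qed.

(** The Gaussian weight is the integral of [e^-u] over [u >= |x|^2 / 2], that is, over the balls of
    radius [sqrt (2 u)] containing [x]. Scaling these balls by [layer_cake] leaves
    [e^-u (2 u)^(p/2 + j)], a Gamma integrand. *)
Lemma gauss_moment_ball t j : gauss_moment p t j =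
  ((2 `^ nu j)%:E * Gammae (nu j + 1) * ball_moment t j)%E.
Proof.
pose rho (u : R) := if 0 < u then expR (- u) else 0.
pose rad (u : R) := Num.sqrt (2 * u).
have mrho : measurable_fun setT rho.
  apply: measurable_fun_ifT => //; first exact: measurable_fun_ltr.
  exact: measurableT_comp.
have mrad : measurable_fun setT rad.
  have ms := continuous_measurable_fun (@sqrt_continuous R).
  by apply: (measurableT_comp ms); exact: measurable_funM.
have rad0 u : rho u != 0 -> 0 < rad u.
  rewrite /rho; case: ifP => [u0 _|_ /eqP//].
  by rewrite sqrtr_gt0 mulr_gt0.
have mg : measurable_fun [set: T] (fun x => dotp t (vec x) ^+ (2 * j)).
  by apply: measurable_funX; exact: measurable_dotp_vec.
have rho0 u : 0 <= rho u by rewrite /rho; case: ifP => // _; exact: expR_ge0.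
have := layer_cake p (2 * j) rho rad (fun x => dotp t x ^+ (2 * j)) mrho rho0
  mrad rad0 mg (fun x => even_exprn_ge0 _ j) _.
have gh a x : 0 < a -> dotp t (a *: x) ^+ (2 * j) = a ^+ (2 * j) * dotp t x ^+ (2 * j).
  by move=> a0; rewrite dotpZr exprMn.
move=> /(_ gh); rewrite -/(ball_moment t j) => lc.
transitivity (\int[lebesgue_measure]_u (rho u * rad u ^+ (p + 2 * j))%:E *
  ball_moment t j)%E.
  rewrite -lc; apply: eq_integral => x _; rewrite EFinM muleC; congr (_ * _)%E.
  rewrite /gauss -integral_expRN_tail ?divr_ge0 ?sqr_ge0//.
  apply: eq_integral => u _; congr EFin; rewrite /rho.
  case: (ltP 0 u) => u0 /=; last by rewrite if_same.
  by rewrite sqr_enorm ler_pdivrMr// (mulrC u) /rad /enorm ler_sqrt ?mulr_ge0// ltW.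
congr (_ * _)%E.
rewrite /Gammae -ge0_integralZl ?lee_fin ?powR_ge0//; last 2 first.
- apply: measurable_funEFin; apply: measurable_fun_ifT => //.
    exact: measurable_fun_ltr.
  by apply: measurable_funM; [exact: measurable_powR|exact: measurableT_comp].
- by move=> u _; rewrite lee_fin; case: ifP => // _; rewrite mulr_ge0 ?powR_ge0 ?expR_ge0.
apply: eq_integral => u _; rewrite -EFinM /rho; congr EFin.
case: ifPn => u0; last by rewrite mul0r mulr0.
have u20 : 0 <= 2 * u :> R by rewrite mulr_ge0// ltW.
rewrite /rad -powR12_sqrt// -powR_mulrn ?powR_ge0// -powRrM.
rewrite mulrC mulrA; congr (_ * _); rewrite addrK powRM ?(ltW u0)//.
have -> : 2^-1 * (p + 2 * j)%:R = nu j :> R by rewrite natrD natrM; field.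
by [].
Qed.

(** With [d = 2 j] and [g] the integrand of the sphere moment, that of the ball moment is [g |x|^d].
    The difference [g (1 - |x|^d)] is a superposition of balls with weight [d u^(d-1)] on [[0, 1]],
    and scaling yields [d / (p + d)]. The relation is stated as a sum because finiteness is not yet
    known. *)
Lemma ball_moment_sphere t j :
  (sphere_moment t j =
   ball_moment t j + ((2 * j)%:R / (p + 2 * j)%:R)%:E * sphere_moment t j)%E.
Proof.
case: j => [|j].
  rewrite muln0 mul0r mul0e adde0 /sphere_moment /ball_moment muln0.
  by under eq_fun do rewrite expr0.
set d := (2 * j.+1)%N.
have d1 : 1 < d%:R :> R by rewrite ltr1n /d mulnS.
have d0 : 0 < d%:R :> R by exact: lt_trans d1.
have pd0 : 0 < (p + d)%:R :> R by rewrite ltr0n addn_gt0 p_gt0.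
pose g x := dotp t (dirn x) ^+ d.
have g0 x : 0 <= g x by exact: even_exprn_ge0.
have mg : measurable_fun [set: T] (fun x => g (vec x)).
  by apply: measurable_funX; exact: measurable_dotp_dirn.
pose rho (u : R) := if (0 <= u) && (u <= 1) then d%:R * u `^ (d%:R - 1) else 0.
have mrho : measurable_fun setT rho.
  apply: measurable_fun_ifT => //.
    by apply: measurable_and; exact: measurable_fun_ler.
  by apply: measurable_funM => //; exact: measurable_powR.
have rho0 u : 0 <= rho u.
  by rewrite /rho; case: ifP => // _; rewrite mulr_ge0 ?powR_ge0.
have rad0 u : rho u != 0 -> 0 < u.
  rewrite /rho; case: ifP => [/andP[u0 _]|_ /eqP//].
  rewrite lt_neqAle u0 andbT; apply: contraNneq => <-.
  by rewrite powR0 ?mulr0// gt_eqF// subr_gt0.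
have gh a x : 0 < a -> g (a *: x) = a ^+ 0 * g x.
  by move=> a0; rewrite /g dirnZ// mul1r.
have := layer_cake p 0 rho id g mrho rho0 (@measurable_id _ _ _) rad0 mg g0 gh.
rewrite -/(sphere_moment t j.+1) addn0.
have -> : (\int[lebesgue_measure]_u (rho u * u ^+ p)%:E = (d%:R / (p + d)%:R)%:E)%E.
  transitivity (\int[lebesgue_measure]_(u in `[0%R, 1%R])
    ((d%:R / (p + d)%:R)%:E * ((p + d)%:R * u `^ ((p + d)%:R - 1 : R))%:E))%E.
    rewrite [RHS]integral_mkcond; apply: eq_integral => u _.
    rewrite patchE /rho; case: ifPn => u01; last first.
      by rewrite mul0r memNset//= in_itv/=; exact/negP.
    rewrite mem_set/= ?in_itv//= -EFinM; congr EFin.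
    have /andP[u0 _] := u01.
    rewrite mulrA divfK ?gt_eqF// -mulrA; congr (_ * _).
    rewrite -powR_mulrn// -powRD; last first.
      by rewrite gt_eqF// addr_gt0 ?subr_gt0 ?ltr0n.
    by rewrite natrD; congr (_ `^ _); ring.
  rewrite ge0_integralZl ?lee_fin ?divr_ge0//.
  - rewrite integral_powR ?lexx ?ler01//; last first.
      by rewrite natrD (lt_le_trans d1)// lerDr.
    by rewrite powR1 powR0 ?gt_eqF// subr0 mule1.
  - apply: measurable_funTS; apply: measurable_funEFin.
    by apply: measurable_funM => //; exact: measurable_powR.
  - by move=> u _; rewrite lee_fin mulr_ge0 ?powR_ge0.
move=> <-.
have mB : measurable_fun [set: T]
    (fun x => (if enorm (vec x) <= 1 then dotp t (vec x) ^+ d else 0)%:E).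
  apply: measurable_funEFin; apply: measurable_fun_ifT => //.
    by apply: measurable_fun_ler => //; exact: measurable_enorm_vec.
  by apply: measurable_funX; exact: measurable_dotp_vec.
have inner (x : T) : (\int[lebesgue_measure]_u
    (if enorm (vec x) <= u then rho u else 0)%:E =
    (if enorm (vec x) <= 1 then 1 - enorm (vec x) ^+ d else 0)%:E)%E.
  set a := enorm (vec x); have a0 : 0 <= a by exact: enorm_ge0.
  have [a1|a1] := leP a 1; last first.
    apply: integral0_eq => u _; case: ifP => // au; rewrite /rho ifF//.
    by apply/negbTE; rewrite negb_and -!ltNge (lt_le_trans a1 au) orbT.
  have -> : 1 - a ^+ d = 1 `^ d%:R - a `^ d%:R by rewrite powR1 powR_mulrn.
  rewrite -integral_powR//.
  rewrite [RHS]integral_mkcond; apply: eq_integral => u _.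
  rewrite patchE /rho; case: ifPn => au; last first.
    by rewrite memNset//= in_itv/= (negbTE au).
  case: ifPn => [/andP[u0 u1]|]; first by rewrite mem_set//= in_itv/= au.
  rewrite (le_trans a0 au)/= => u1.
  by rewrite memNset//= in_itv/= au (negbTE u1).
under [X in (_ + X)%E]eq_integral do rewrite inner.
rewrite /ball_moment /ball_int -ge0_integralD//; last 3 first.
- by move=> x _; case: ifP; rewrite lee_fin// even_exprn_ge0.
- move=> x _; rewrite mule_ge0 ?lee_fin//; case: ifP => // x1.
  by rewrite subr_ge0 exprn_ile1 ?enorm_ge0.
- apply: emeasurable_funM; first exact: measurable_funEFin.
  apply: measurable_funEFin; apply: measurable_fun_ifT => //.
    by apply: measurable_fun_ler => //; exact: measurable_enorm_vec.
  by apply: measurable_funB => //; apply: measurable_funX; exact: measurable_enorm_vec.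
apply: eq_integral => x _; rewrite -EFinM -EFinD; congr EFin.
case: ifP => _; last by rewrite mulr0 addr0.
suff -> : dotp t (vec x) ^+ d = g (vec x) * enorm (vec x) ^+ d by rewrite /g; ring.
rewrite /g dotp_dirn exprMn exprVn mulrAC.
(* At the origin the inverse norm is the default 0; both sides vanish because [d] is positive. *)
have [x0|x0] := eqVneq (enorm (vec x)) 0; last by rewrite mulVf ?mul1r// expf_neq0.
have /eqP -> : dotp t (vec x) == 0.
  by rewrite -normr_le0 (le_trans (ler_norm_dotp _ _))// x0 mulr0.
by rewrite expr0n/= mulr0.
Qed.

End sphere_moments.

(** * The exponential integral over the sphere as an entire series in [|t|^2] *)

Section sphere_exponential.
Context {R : realType} (p : nat).
Hypothesis p_gt0 : (0 < p)%N.
Local Notation T := (ss_type R (cube p)).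
Local Notation mu := (ss_mu (cube p)).
Local Notation vec := (@vec R p).
Local Notation dirn := (@dirn R p).
Local Notation ball_int := (@ball_int R p).
Implicit Types (t : 'rV[R]_p) (j : nat).
Local Notation K := (Num.sqrt (2 * pi) ^+ p : R).
Local Notation nu j := (p%:R / 2 + j%:R : R).

(* The Gaussian moments are finite and positive, so neither factor of
   [gauss_moment_ball] can be [0] or [+oo]. *)
Lemma Gammae_pos j : (0 < Gammae (nu j + 1) < +oo)%E.
Proof.
pose e : 'rV[R]_p := delta_mx 0 (Ordinal p_gt0).
have e1 : dotp e e = 1 by exact: dotp_delta.
have G0 : (0 <= Gammae (nu j + 1))%E.
  apply: integral_ge0 => u _; rewrite lee_fin; case: ifP => // _.
  by rewrite mulr_ge0 ?powR_ge0 ?expR_ge0.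
have B0 : (0 <= ball_moment p e j)%E.
  by apply: ball_int_ge0 => x; exact: even_exprn_ge0.
have c0 : 0 < 2 `^ nu j :> R by exact: powR_gt0.
have := gauss_moment_ball p e j; rewrite gauss_momentE// e1.
set k := (X in X%:E) => kE.
have k0 : 0 < k.
  rewrite /k !mulr_gt0 ?gaussian_mass_gt0 ?invr_gt0 ?exprn_gt0 ?divr_gt0//.
apply/andP; split.
  rewrite lt_neqAle G0 andbT; apply/eqP => G00; move: kE.
  by rewrite -G00 mule0 mul0e => -[kk]; rewrite kk ltxx in k0.
rewrite ltey; apply/eqP => Goo; move: kE; rewrite Goo gt0_muley ?lte_fin//.
have [->|Bn0] := eqVneq (ball_moment p e j) 0%E.
  by rewrite mule0 => -[kk]; rewrite kk ltxx in k0.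
by rewrite gt0_mulye// lt_neqAle eq_sym Bn0.
Qed.

Lemma Gamma_gt0 j : 0 < Gamma (nu j + 1).
Proof. by rewrite GammaE fine_gt0// Gammae_pos. Qed.

Lemma Gammae_fin j : Gammae (nu j + 1) = (Gamma (nu j + 1))%:E.
Proof.
rewrite GammaE fineK//; have /andP[G0 Goo] := Gammae_pos j.
by rewrite ge0_fin_numE// ltW.
Qed.

(** For [0 < j], [nu j = nu (j - 1) + 1] exceeds 1, as [Gammae_recurrence] asks, and is a point
    where [Gammae] is already known to be finite. *)
Lemma Gamma_rec j : (0 < j)%N -> Gamma (nu j + 1) = nu j * Gamma (nu j).
Proof.
case: j => // j _; have nuS : nu j.+1 = nu j + 1 by rewrite -[j.+1%:R]natr1 addrA.
apply: EFin_inj; rewrite -Gammae_fin Gammae_recurrence nuS.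
  by rewrite Gammae_fin EFinM.
by rewrite ltrDr ltr_wpDr// divr_gt0// ltr0n.
Qed.

Lemma ball_momentE t j : ball_moment p t j =
  (K * (2 * j)`!%:R / j`!%:R * (dotp t t / 2) ^+ j /
   (2 `^ nu j * Gamma (nu j + 1)))%:E.
Proof.
have c0 : 0 < 2 `^ nu j * Gamma (nu j + 1) :> R by rewrite mulr_gt0 ?powR_gt0 ?Gamma_gt0.
have := gauss_moment_ball p t j; rewrite gauss_momentE// Gammae_fin -EFinM => kE.
rewrite [RHS]EFinM kE muleAC -EFinM divff ?mul1e// gt_eqF//.
Qed.

(** The sphere moment is at most a constant times the volume [ball_moment p 0 0], hence finite;
    [ball_moment_sphere] is then a linear equation for it. *)
Lemma sphere_momentE t j : (p%:R%:E * sphere_moment p t j =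
  ((p + 2 * j)%:R * fine (ball_moment p t j))%:E)%E.
Proof.
have pR : 0 < p%:R :> R by rewrite ltr0n.
have pdR : 0 < (p + 2 * j)%:R :> R by rewrite ltr0n addn_gt0 p_gt0.
pose M := (\sum_i `|t 0 i|) ^+ (2 * j).
have B0 t' j' : (0 <= ball_moment p t' j')%E.
  by apply: ball_int_ge0 => x; exact: even_exprn_ge0.
have mball (g : 'rV[R]_p -> R) : measurable_fun [set: T] (fun x => g (vec x)) ->
    measurable_fun [set: T] (fun x => (if enorm (vec x) <= 1 then g (vec x) else 0)%:E).
  move=> mg; apply: measurable_funEFin; apply: measurable_fun_ifT => //.
  by apply: measurable_fun_ler => //; exact: measurable_enorm_vec.
have Cfin : sphere_moment p t j \is a fin_num.
  rewrite ge0_fin_numE; last by apply: ball_int_ge0 => x; exact: even_exprn_ge0.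
  apply: (@le_lt_trans _ _ (M%:E * ball_moment p 0 0)%E); last first.
    by rewrite ball_momentE ltry.
  have M0 : 0 <= M by exact: even_exprn_ge0.
  rewrite /ball_moment /ball_int -ge0_integralZl ?lee_fin//.
  - apply: ge0_le_integral => //.
    + by move=> x _; rewrite lee_fin; case: ifP => // _; exact: even_exprn_ge0.
    + apply: (mball (fun x => dotp t (dirn x) ^+ (2 * j))).
      by apply: measurable_funX; exact: measurable_dotp_dirn.
    + apply: measurable_funeM; apply: (mball (fun x => dotp 0 x ^+ (2 * 0))).
      by apply: measurable_funX; exact: measurable_dotp_vec.
    + move=> x _; rewrite -EFinM lee_fin; case: ifP => _; last by rewrite mulr0.
      rewrite muln0 expr0 mulr1 -[leLHS]ger0_norm ?even_exprn_ge0// normrX.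
      rewrite lerXn2r ?nnegrE ?sumr_ge0//.
      exact: ler_norm_dotp_dirn.
  - apply: (mball (fun x => dotp 0 x ^+ (2 * 0))).
    by apply: measurable_funX; exact: measurable_dotp_vec.
  - by move=> x _; rewrite lee_fin; case: ifP => // _; exact: even_exprn_ge0.
have Bfin : ball_moment p t j \is a fin_num by rewrite ball_momentE.
rewrite -(fineK Cfin) -EFinM; congr EFin.
have := ball_moment_sphere p p_gt0 t j.
rewrite -(fineK Cfin) -(fineK Bfin) -EFinM -EFinD => -[]; rewrite /=.
set C := fine _; set B := fine _ => CE.
have {}CE : C * (p + 2 * j)%:R = B * (p + 2 * j)%:R + (2 * j)%:R * C.
  by rewrite {1}CE mulrDl mulrAC divfK// gt_eqF.
have -> : p%:R * C = C * (p + 2 * j)%:R - (2 * j)%:R * C by rewrite natrD; ring.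
by rewrite CE addrK mulrC.
Qed.

(** Coefficients of [H]; classically [H (k^2)] is [(2 pi)^(p/2) k^(1 - p/2) I_(p/2-1) (k)]. The
    factor [p + 2 j] is not absorbed into the Gamma value, since [Gamma_rec] covers only positive
    [j]. *)
Definition exp_coef j : R :=
  K * (p + 2 * j)%:R / (j`!%:R * 4 ^+ j * 2 `^ (p%:R / 2) * Gamma (nu j + 1)).

Lemma sphere_moment_coef t j :
  (p%:R%:E * ((2 * j)`!%:R^-1%:E * sphere_moment p t j) =
   (exp_coef j * dotp t t ^+ j)%:E)%E.
Proof.
rewrite muleCA sphere_momentE ball_momentE -EFinM; congr EFin => /=.
rewrite powRD; last by rewrite (pnatr_eq0 _ 2) implybT.
rewrite powR_mulrn// expr_div_n /exp_coef.
have -> : 4 = 2 * 2 :> R by ring.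
rewrite exprMn.
have f1 : (2 * j)`!%:R != 0 :> R by rewrite pnatr_eq0 -lt0n fact_gt0.
have f2 : j`!%:R != 0 :> R by rewrite pnatr_eq0 -lt0n fact_gt0.
have f3 : 2 ^+ j != 0 :> R by rewrite expf_neq0.
have f4 : 2 `^ (p%:R / 2) != 0 :> R by rewrite gt_eqF// powR_gt0.
have f5 := gt_eqF (Gamma_gt0 j).
by field; rewrite f1 f2 f3 f4 f5.
Qed.

Definition cone (g : 'rV[R]_p -> R) x : R :=
  if (0 < enorm x) && (enorm x <= 1) then g (dirn x) else 0.

Lemma sphere_intE (g : 'rV[R]_p -> R) :
  sphere_int (EFin \o g) = (p%:R%:E * lebesgue_int (EFin \o cone g))%E.
Proof.
rewrite /sphere_int; congr (_ * lebesgue_int _)%E; apply/funext => x.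
by rewrite /cone /=; case: ifP.
Qed.

Lemma measurable_cone (g : 'rV[R]_p -> R) :
  measurable_fun [set: T] (fun x => g (dirn (vec x))) ->
  measurable_fun [set: T] (fun x => cone g (vec x)).
Proof.
move=> mg; apply: measurable_fun_ifT => //; apply: measurable_and.
  by apply: measurable_fun_ltr => //; exact: measurable_enorm_vec.
by apply: measurable_fun_ler => //; exact: measurable_enorm_vec.
Qed.

Lemma lebesgue_int_coneE (M : R) (g : 'rV[R]_p -> R) :
  measurable_fun [set: T] (fun x => g (dirn (vec x))) ->
  (forall x, `|g (dirn x)| <= M) ->
  mu.-integrable [set: T] (fun x => (cone g (vec x))%:E) /\
  lebesgue_int (EFin \o cone g) = (\int[mu]_x (cone g (vec x))%:E)%E.
Proof.
move=> mg gM; apply: (lebesgue_int_unit_ballE p M) => [|x|x x1].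
- exact: measurable_cone.
- by rewrite /cone; case: ifP => // _; rewrite normr0 (le_trans _ (gM 0)).
- by rewrite /cone (leNgt _ 1) x1 andbF.
Qed.

Lemma measurable_expR_dirn t :
  measurable_fun [set: T] (fun x => expR (dotp t (dirn (vec x)))).
Proof. by apply: measurableT_comp => //; exact: measurable_dotp_dirn. Qed.

Lemma cone_expR_integrable t :
  mu.-integrable [set: T] (fun x => (cone (fun y => expR (dotp t y)) (vec x))%:E) /\
  lebesgue_int (EFin \o cone (fun y => expR (dotp t y))) =
    (\int[mu]_x (cone (fun y => expR (dotp t y)) (vec x))%:E)%E.
Proof.
apply: (lebesgue_int_coneE (expR (\sum_i `|t 0 i|))).
  exact: measurable_expR_dirn.
move=> x; rewrite ger0_norm ?expR_ge0// ler_expR.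
exact: le_trans (ler_norm _) (ler_norm_dotp_dirn _ t x).
Qed.

(** By the reflection [x -> - x] the exponential may be replaced by [cosh], whose even series
    integrates termwise. *)
Lemma cone_expR_series t :
  (\int[mu]_x (cone (fun y => expR (dotp t y)) (vec x))%:E =
   \sum_(j <oo) ((2 * j)`!%:R^-1%:E * sphere_moment p t j))%E.
Proof.
pose G s := cone (fun y => expR (dotp s y)).
have G0 s x : (0 <= (G s x)%:E)%E.
  by rewrite lee_fin /G /cone; case: ifP => // _; exact: expR_ge0.
have mG s : measurable_fun [set: T] (fun x => (G s (vec x))%:E).
  by apply: measurable_funEFin; apply: measurable_cone; exact: measurable_expR_dirn.
have enormN (x : 'rV[R]_p) : enorm (- x) = enorm x.
  by rewrite -scaleN1r enormZ normrN1 mul1r.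
have GN : (\int[mu]_x (G (- t) (vec x))%:E = \int[mu]_x (G t (vec x))%:E)%E.
  have [_ <-] := integral_vec_opp p (fun x => (G t x)%:E) (mG t) (G0 t).
  apply: eq_integral => x _; rewrite /G /cone enormN; case: ifP => // _.
  congr (expR _)%:E.
  by rewrite !dotp_dirn enormN -(scaleN1r t) -(scaleN1r (vec x)) dotpZl dotpZr.
pose w (x : T) : R := if enorm (vec x) <= 1 then 1 else 0.
have w0 x : 0 <= w x by rewrite /w; case: ifP.
have mw : measurable_fun setT w.
  apply: measurable_fun_ifT => //.
  by apply: measurable_fun_ler => //; exact: measurable_enorm_vec.
transitivity (\int[mu]_x (w x * cosh (dotp t (dirn (vec x))))%:E)%E; last first.
  rewrite integral_cosh//; last exact: measurable_dotp_dirn.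
  apply: eq_eseriesr => j _; congr (_ * _)%E; apply: eq_integral => x _.
  by rewrite /w; case: ifP; rewrite ?mul1r ?mul0r.
(* [cone] drops the origin, while the [cosh] integral keeps it with value [cosh 0 = 1]; the last
   term is this null discrepancy. *)
transitivity (2^-1%:E * (\int[mu]_x (G t (vec x))%:E + \int[mu]_x (G (- t) (vec x))%:E)
    + \int[mu]_x (enorm (vec x) == 0)%:R%:E)%E.
  rewrite integral_vec0// adde0 GN -mule2n -mule_natl muleA -EFinM.
  by rewrite mulVf ?mul1e.
rewrite -ge0_integralD// -ge0_integralZl//; last 2 first.
- exact: emeasurable_funD.
- by move=> x _; exact: adde_ge0.
rewrite -ge0_integralD//; last 3 first.
- by move=> x _; rewrite mule_ge0 ?adde_ge0// lee_fin.
- by apply: measurable_funeM; exact: emeasurable_funD.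
- apply: measurable_funEFin.
  have -> : (fun x => (enorm (vec x) == 0)%:R) =
      (fun x => if enorm (vec x) <= 0 then 1 else 0 : R).
    apply/funext => x; rewrite le_eqVlt ltNge enorm_ge0 orbF.
    by case: eqP.
  apply: measurable_fun_ifT => //.
  by apply: measurable_fun_ler => //; exact: measurable_enorm_vec.
apply: eq_integral => x _; rewrite -[X in (_ * X)%E]EFinD -EFinM -EFinD; congr EFin.
rewrite /G /cone /w.
have [x0|x0] := eqVneq (enorm (vec x)) 0.
  rewrite x0 ltxx ler01/= addr0 mulr0 add0r dotp_dirn x0 invr0 mul0r.
  by rewrite /cosh oppr0 expR0; field.
rewrite lt_neqAle eq_sym x0 enorm_ge0/= addr0; case: ifP => _; last first.
  by rewrite addr0 mulr0 mul0r.
by rewrite -(scaleN1r t) dotpZl mulN1r /cosh; field.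
Qed.

Lemma sphere_int_expR_nneseries t :
  sphere_int (fun x => (expR (dotp t x))%:E) =
  (\sum_(j <oo) (exp_coef j * dotp t t ^+ j)%:E)%E.
Proof.
rewrite -[X in sphere_int X]/(EFin \o (fun x => expR (dotp t x))) sphere_intE.
rewrite (cone_expR_integrable t).2 cone_expR_series -nneseriesZl.
  by apply: eq_eseriesr => j _; exact: sphere_moment_coef.
move=> j _; rewrite mule_ge0 ?lee_fin ?invr_ge0//.
by apply: ball_int_ge0 => x; exact: even_exprn_ge0.
Qed.

Lemma exp_coef_ge0 j : 0 <= exp_coef j.
Proof.
by rewrite divr_ge0// ?mulr_ge0 ?powR_ge0 ?exprn_ge0 ?(ltW (Gamma_gt0 j))// sqrtr_ge0.
Qed.

(** Convergence comes from integrability: at [y >= 0] the series is the exponential integral for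
    some [t] with [|t|^2 = y], and this is finite. Other arguments lie inside a larger radius. *)
Lemma cvg_exp_coef z : cvgn (pseries exp_coef z).
Proof.
suff H y : 0 <= y -> cvgn (pseries exp_coef y).
  apply: (@is_cvg_pseries_inside _ _ (`|z| + 1)); first by apply: H; rewrite addr_ge0.
  by rewrite [ltRHS]ger0_norm ?addr_ge0// ltrDl.
move=> y0.
pose e : 'rV[R]_p := delta_mx 0 (Ordinal p_gt0).
have e1 : dotp e e = 1 by exact: dotp_delta.
pose t := Num.sqrt y *: e.
have tE : dotp t t = y by rewrite dotpZl dotpZr e1 mulr1 -expr2 sqr_sqrtr.
have := sphere_int_expR_nneseries t; rewrite tE => sE.
apply: nnseries_is_cvg => [j|]; first by rewrite mulr_ge0 ?exp_coef_ge0// exprn_ge0.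
rewrite -sE -[X in sphere_int X]/(EFin \o (fun x => expR (dotp t x))) sphere_intE.
have [ti ->] := cone_expR_integrable t.
by rewrite -(fineK (integrable_fin_num _ ti))// -EFinM ltry.
Qed.

Lemma sphere_int_expR t : sphere_int (fun x => (expR (dotp t x))%:E) =
  (limn (pseries exp_coef (dotp t t)))%:E.
Proof.
rewrite sphere_int_expR_nneseries; apply/nneseries_EFinP.
  by move=> j; rewrite mulr_ge0 ?exp_coef_ge0// exprn_ge0// dotp_ge0.
exact: cvg_exp_coef.
Qed.

End sphere_exponential.

(** * The exponentially tilted first moment *)

Lemma fine_leD (R : realType) (a b c : \bar R) (s : R) :
  a \is a fin_num -> b \is a fin_num -> c \is a fin_num ->
  (a + s%:E * c <= b)%E -> fine a + s * fine c <= fine b.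
Proof. by case: a b c => [a||] [b||] [c||]//= _ _ _; rewrite -EFinM -EFinD lee_fin. Qed.

Section sphere_tilt.
Context {R : realType} (p : nat).
Hypothesis p_gt0 : (0 < p)%N.
Local Notation mu := (ss_mu (cube p)).
Local Notation vec := (@vec R p).
Local Notation dirn := (@dirn R p).
Implicit Types (t v : 'rV[R]_p).
Local Notation K := (Num.sqrt (2 * pi) ^+ p : R).

Definition tilt t v : 'rV[R]_p -> R := fun x => expR (dotp t x) * dotp v x.

(** The scalar [a] lets one bound serve both the tilted moment and its multiple by the vMF
    constant. *)
Lemma cone_tiltE (a : R) t v :
  mu.-integrable setT (fun x => (cone p (fun y => a * tilt t v y) (vec x))%:E) /\
  lebesgue_int (EFin \o cone p (fun y => a * tilt t v y)) =
    (\int[mu]_x (cone p (fun y => a * tilt t v y) (vec x))%:E)%E.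
Proof.
apply: (lebesgue_int_coneE p (`|a| * (expR (\sum_i `|t 0 i|) * \sum_i `|v 0 i|))).
  apply: measurable_funM => //; apply: measurable_funM.
    exact: measurable_expR_dirn.
  exact: measurable_dotp_dirn.
move=> x; rewrite !normrM ler_wpM2l// ler_pM// ?ler_norm_dotp_dirn//.
rewrite ger0_norm ?expR_ge0// ler_expR.
exact: le_trans (ler_norm _) (ler_norm_dotp_dirn _ t x).
Qed.

(* [expR y >= 1 + y] makes the tilted moment a subgradient, hence the derivative:
   no differentiation under the integral sign is needed. *)
Lemma sphere_int_tilt t v :
  sphere_int (fun x => (tilt t v x)%:E) =
  (2 * dotp t v * limn (pseries (pseries_diffs (exp_coef p)) (dotp t t)))%:E.
Proof.
have pR0 : 0 <= p%:R :> R by [].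
have -> : (fun x => (tilt t v x)%:E) = EFin \o (fun x => 1 * tilt t v x).
  by apply/funext => x /=; rewrite mul1r.
rewrite sphere_intE; have [Vi ->] := cone_tiltE 1 t v.
set V := (\int[mu]_x _)%E.
have Vfin : V \is a fin_num by exact: integrable_fin_num.
pose H z := limn (pseries (exp_coef p) z : R^nat).
pose Phi s := H (dotp (t + s *: v) (t + s *: v)).
have convex s : Phi 0 + s * (p%:R * fine V) <= Phi s.
  have PhiE r : (Phi r)%:E = (p%:R%:E *
      \int[mu]_x (cone p (fun y => expR (dotp (t + r *: v) y)) (vec x))%:E)%E.
    rewrite /Phi /H -sphere_int_expR//.
    rewrite -[X in sphere_int X]/(EFin \o (fun x => expR (dotp (t + r *: v) x))).
    by rewrite sphere_intE (cone_expR_integrable p (t + r *: v)).2.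
  pose G r := fun x => (cone p (fun y => expR (dotp (t + r *: v) y)) (vec x))%:E.
  have Gi r : mu.-integrable setT (G r) by exact: (cone_expR_integrable p _).1.
  have GF r : Phi r = p%:R * fine (\int[mu]_x G r x)%E.
    by apply: EFin_inj; rewrite PhiE EFinM fineK//; exact: integrable_fin_num.
  have Gfin r : (\int[mu]_x G r x)%E \is a fin_num by exact: integrable_fin_num.
  rewrite (GF 0) (GF s).
  rewrite [s * _]mulrCA.
  rewrite -mulrDr.
  apply: ler_wpM2l => //.
  apply: fine_leD => //.
  rewrite -integralZl// -integralD//; last exact: integrableZl.
  apply: le_integral => //.
    by apply: integrableD => //; exact: integrableZl.
  move=> x _; rewrite /G /cone /tilt -EFinM -EFinD lee_fin.
  case: ifP => _; last by rewrite mulr0 addr0.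
  rewrite !dotpDl !dotpZl mul0r addr0 expRD.
  have -> : expR (dotp t (dirn (vec x))) + s * (1 * (expR (dotp t (dirn (vec x))) *
      dotp v (dirn (vec x)))) = expR (dotp t (dirn (vec x))) *
      (1 + s * dotp v (dirn (vec x))) by ring.
  by rewrite ler_wpM2l ?expR_ge0// expR_ge1Dx.
pose q (s : R) := dotp t t + s * (2 * dotp t v) + s ^+ 2 * dotp v v.
have PhiE : Phi = H \o q by apply/funext => s; rewrite /Phi sqr_enormDZ.
have dq (s : R) : is_derive s 1 q (2 * dotp t v + 2 * s * dotp v v).
  apply: is_derive_eq; rewrite /GRing.scale/=; ring.
have dH z := is_derive_pseries _ (cvg_exp_coef p p_gt0) z.
have dPhi (s : R) : is_derive s 1 Phi
    (limn (pseries (pseries_diffs (exp_coef p)) (q s)) *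
     (2 * dotp t v + 2 * s * dotp v v)).
  by rewrite PhiE; exact: is_derive1_comp.
pose D := p%:R * fine V.
pose f (s : R) := Phi s - s * D.
have df (s : R) : is_derive s 1 f
    (limn (pseries (pseries_diffs (exp_coef p)) (q s)) *
     (2 * dotp t v + 2 * s * dotp v v) - D).
  by apply: is_derive_eq; rewrite /GRing.scale/=; ring.
(* By [convex], [f] is minimal at 0, so its derivative vanishes there, which determines [D]. *)
have f0 : is_derive (0 : R) 1 f 0.
  have f0min s : s \in `]-1, 1[%R -> f 0 <= f s.
    by move=> _; rewrite /f mul0r subr0 lerBrDr; exact: convex.
  have fder s : s \in `]-1, 1[%R -> derivable f s 1 by have [] := df s.
  have in0 : (0 : R) \in `]-1, 1[%R by rewrite in_itv/=; apply/andP; split; lra.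
  have le11 : -1 <= 1 :> R by lra.
  exact: (derive1_at_min le11 fder in0 f0min).
have [_ f0E] := f0; have [_] := df 0; rewrite f0E => /esym/eqP.
rewrite subr_eq0 => /eqP DE.
rewrite -[V in LHS]fineK// -EFinM -/D -DE; congr EFin.
by rewrite /q !mul0r expr0n/= mul0r !addr0 mulr0 mul0r addr0 mulrC.
Qed.

End sphere_tilt.

(** * Bessel functions and the vMF divergence *)

Section bessel.
Context {R : realType} (p : nat).
Hypothesis p_gt0 : (0 < p)%N.
Local Notation K := (Num.sqrt (2 * pi) ^+ p : R).

Lemma sqrt_exprnE : K = (2 * pi) `^ (p%:R / 2).
Proof.
have pi0 : 0 <= 2 * pi :> R by rewrite mulr_ge0 ?pi_ge0.
by rewrite -powR12_sqrt// -powR_mulrn ?powR_ge0// -powRrM [_^-1 * _]mulrC.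
Qed.

(** Termwise: [p + 2 (j + 1)] is twice the factor extracted by [Gamma_rec], and the [j + 1] of the
    derivative reduces the factorial. In Bessel terms this is [(x^-m I_m)' = x^-m I_(m+1)] with
    [m = p/2 - 1]. *)
Lemma besselI_half (k : R) : 0 < k ->
  K * besselI (p%:R / 2) k =
  k `^ (p%:R / 2) * (2 * limn (pseries (pseries_diffs (exp_coef p)) (k ^+ 2))).
Proof.
move=> k0.
have cd := cvg_pseries_diffs _ (cvg_exp_coef p p_gt0) (k ^+ 2) : cvgn _.
have K0 : K != 0 :> R by rewrite gt_eqF// gaussian_mass_gt0.
suff -> : besselI (p%:R / 2) k = K^-1 * (k `^ (p%:R / 2) *
    (2 * limn (pseries (pseries_diffs (exp_coef p)) (k ^+ 2)))) by rewrite mulVKf.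
apply/cvg_lim => //.
rewrite (_ : (fun n => _) = (fun n => K^-1 * (k `^ (p%:R / 2) *
    (2 * pseries (pseries_diffs (exp_coef p)) (k ^+ 2) n)))).
  by do 3 (apply: cvgM; first exact: cvg_cst); exact: cd.
apply/funext => n; rewrite /pseries seriesEnat/= !mulr_sumr.
apply: eq_bigr => j _; rewrite /pseries_diffs /exp_coef.
rewrite Gamma_rec//.
have -> : j%:R + p%:R / 2 + 1 = p%:R / 2 + j.+1%:R :> R by rewrite -[j.+1%:R]natr1; ring.
rewrite powRD; last by rewrite (gt_eqF (divr_gt0 k0 _)) ?implybT.
rewrite -natrM powR_mulrn ?divr_ge0 ?(ltW k0)// powRM ?invr_ge0 ?(ltW k0)//.
rewrite factS natrM exprS.
have -> : 2^-1 `^ (p%:R / 2) = (2 `^ (p%:R / 2))^-1 :> R.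
  by rewrite -powR_inv1// -powRrM mulN1r powRN.
have -> : (k / 2) ^+ (2 * j) = (k ^+ 2) ^+ j / 4 ^+ j.
  by rewrite exprM expr_div_n expr_div_n; congr (_ / _ ^+ _); ring.
have -> : (p + 2 * j.+1)%:R = 2 * (p%:R / 2 + j.+1%:R) :> R.
  by rewrite natrD natrM; field.
have f1 : j`!%:R != 0 :> R by rewrite pnatr_eq0 -lt0n fact_gt0.
have f2 : j.+1%:R != 0 :> R by rewrite pnatr_eq0.
have f3 : p%:R / 2 + j.+1%:R != 0 :> R by rewrite gt_eqF// ltr_wpDl// divr_ge0.
have f4 : 2 `^ (p%:R / 2) != 0 :> R by rewrite gt_eqF// powR_gt0.
have f5 : Gamma (p%:R / 2 + j.+1%:R) != 0 :> R.
  by rewrite gt_eqF// -[j.+1%:R]natr1 addrA Gamma_gt0.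
have f6 : 4 ^+ j != 0 :> R by rewrite expf_neq0.
move: f1 f2 f3 f4 f5 f6 K0.
set G := Gamma _; set nu := p%:R / 2 + _; set w := 2 `^ _; set f := 4 ^+ j.
set js := j.+1%:R; set fa := j`!%:R; set KK := _ ^+ p.
move=> f1 f2 f3 f4 f5 f6 K0.
clearbody G nu w f js fa KK; field.
by rewrite f1 f2 f3 f4 f5 f6 K0.
Qed.

End bessel.

Section von_mises_fisher.
Context {R : realType} (p : nat) (kappa : R).
Hypotheses (p_gt0 : (0 < p)%N) (kappa_gt0 : 0 < kappa).
Hypothesis I_neq0 : besselI (p%:R / 2 - 1) kappa != 0.
Implicit Types zi zj x : 'rV[R]_p.

Lemma vmf_c_neq0 : vmf_c p kappa != 0.
Proof.
by rewrite !mulf_neq0 ?invr_neq0// ?mulf_neq0// gt_eqF// powR_gt0// mulr_gt0 ?pi_gt0.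
Qed.

Lemma ln_vmf_ratio zi zj x :
  ln (vmf_density kappa zi x / vmf_density kappa zj x) = kappa * dotp (zi - zj) x.
Proof.
rewrite /vmf_density invfM mulrACA divff ?vmf_c_neq0// mul1r -expRN -expRD expRK.
by rewrite dotpDl -(scaleN1r zj) dotpZl mulN1r mulrBr.
Qed.

(** Up to powers of [kappa] and [2 pi], [2 H'(kappa^2)] is [I_(p/2)] by [besselI_half], while
    [I_(p/2-1)] enters as the denominator of [vmf_c]; their quotient is [Ap]. *)
Lemma KL_sphere_vmf zi zj : unit_sphere zi ->
  KL_sphere (vmf_density kappa zi) (vmf_density kappa zj) =
  (kappa * Ap p kappa * (1 - dotp zi zj))%:E.
Proof.
move=> zi1; have zi2 : dotp zi zi = 1 by rewrite -sqr_enorm zi1 expr1n.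
pose c := vmf_c p kappa * kappa.
pose t := kappa *: zi; pose v := zi - zj.
transitivity (c%:E * sphere_int (fun x => (tilt p t v x)%:E))%E.
  have -> : (fun x => (tilt p t v x)%:E) = EFin \o (fun x => 1 * tilt p t v x).
    by apply/funext => x /=; rewrite mul1r.
  rewrite /KL_sphere.
  have -> : (fun x => (vmf_density kappa zi x *
      ln (vmf_density kappa zi x / vmf_density kappa zj x))%:E) =
      EFin \o (fun x => c * tilt p t v x).
    apply/funext => x /=; rewrite ln_vmf_ratio /vmf_density /tilt dotpZl /c; congr EFin.
    by ring.
  rewrite !sphere_intE muleCA; congr (_ * _)%E.
  have [_ ->] := cone_tiltE p c t v; have [fi ->] := cone_tiltE p 1 t v.
  rewrite -integralZl//; apply: eq_integral => x _; rewrite -EFinM /cone mul1r.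
  by case: ifP; rewrite ?mulr0.
rewrite sphere_int_tilt// -EFinM; congr EFin.
have tt : dotp t t = kappa ^+ 2 by rewrite dotpZl dotpZr zi2 mulr1 expr2.
have tv : dotp t v = kappa * (1 - dotp zi zj).
  by rewrite dotpZl dotpC dotpDl -(scaleN1r zj) dotpZl mulN1r zi2 (dotpC zj).
have := besselI_half p p_gt0 kappa kappa_gt0.
rewrite tt tv /c /Ap /vmf_c -sqrt_exprnE.
set L := limn _; set K := _ ^+ p; set I0 := besselI (p%:R / 2 - 1) kappa.
set I1 := besselI (p%:R / 2) kappa => KI1.
have K0 : K != 0 by rewrite gt_eqF// gaussian_mass_gt0.
have -> : I1 = K^-1 * (kappa `^ (p%:R / 2) * (2 * L)) by rewrite -KI1 mulKf.
have -> : kappa `^ (p%:R / 2 - 1) = kappa `^ (p%:R / 2) / kappa.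
  by rewrite powRB ?powRr1 ?(ltW kappa_gt0)// (gt_eqF kappa_gt0) implybT.
by field; rewrite I_neq0 K0 gt_eqF.
Qed.

End von_mises_fisher.

(** The common factor [e^C] cancels from the softmax quotient. *)
Lemma infoNCE_shift (R : realType) (C : R) (N : nat) (i : 'I_N) (s : R) (n : 'I_N -> R) :
  infoNCE i (s + C) (fun j => n j + C) = infoNCE i s n.
Proof.
rewrite /infoNCE expRD; congr (- ln _).
under eq_bigr do rewrite expRD.
by rewrite -mulr_suml -mulrDl invfM mulrACA divff ?mulr1// gt_eqF// expR_gt0.
Qed.

Theorem theorem1 (R : realType) (p : nat) (tau kappa : R) :
  (2 <= p)%N -> 0 < tau -> 0 < kappa -> Ap p kappa * kappa = tau^-1 ->
  (exists C : R, forall zi zj : 'rV[R]_p,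
      unit_sphere zi -> unit_sphere zj ->
      sim_div_e (vmf_density kappa zi) (vmf_density kappa zj)
        = (sim_cos zi zj / tau + C)%:E) /\
  (forall (N : nat) (i : 'I_N) (z : 'I_N -> 'rV[R]_p) (zplus : 'rV[R]_p),
      (forall j, unit_sphere (z j)) -> unit_sphere zplus ->
      L_div kappa i z zplus = L_cos tau i z zplus).
Proof.
move=> p2 tau0 kappa0 Atau.
(* Division by zero yields 0, so a vanishing denominator would make [Ap p kappa * kappa] equal to 0
   instead of [tau^-1]. *)
have I_neq0 : besselI (p%:R / 2 - 1) kappa != 0.
  apply/eqP => I0; move: Atau; rewrite /Ap I0 invr0 mulr0 mul0r => /esym/eqP.
  by rewrite invr_eq0 gt_eqF.
(* The constant is [- tau^-1], since the divergence vanishes for equal unit directions. *)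
have simE (zi zj : 'rV[R]_p) : unit_sphere zi ->
    sim_div_e (vmf_density kappa zi) (vmf_density kappa zj) =
    (sim_cos zi zj / tau + - tau^-1)%:E.
  move=> zi1; rewrite /sim_div_e KL_sphere_vmf// ?(ltnW p2)// -EFinN; congr EFin.
  by rewrite [kappa * _]mulrC Atau /sim_cos; ring.
split=> [|N i z zplus z1 _]; first by exists (- tau^-1) => zi zj zi1 _; exact: simE.
rewrite /L_div /L_cos -[RHS](infoNCE_shift _ (- tau^-1)); congr (infoNCE _ _ _).
  by rewrite /sim_div simE.
by apply/funext => j; rewrite /sim_div simE.
Qed.
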